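(* Let $\Gamma=H_1*_K H_2$ be an amalgamated free product of abstract groups with common subgroup $K$, and fix a prime $p$. Assume that the splitting has exact pro-$p$ entrance and put $G_i=\widehat{(H_i)}_p$ and $A=\widehat K_p$. Assume that $A$ is properly contained in $G_i$ for $i=1,2$. Then $\widehat\Gamma_p$ is boundedly generated if and only if $A$ is boundedly generated and $p=[G_1:A]=[G_2:A]=2$.
   Context: $\widehat G_p$ denotes the pro-$p$ completion of an abstract group $G$. A profinite group $G$ is boundedly generated if $G=\overline{\langle g_1\rangle}\cdots\overline{\langle g_d\rangle}$ for finitely many $g_1,\dots,g_d\in G$. For pro-$p$ groups $G_1,G_2$ with a common closed subgroup $A$, $G_1\amalg_A G_2$ is the pushout of $G_1\leftarrow A\rightarrow G_2$ in the category of pro-$p$ groups; it is proper if the canonical maps $G_i\to G_1\amalg_A G_2$ are injective. The splitting $\Gamma=H_1*_K H_2$ has exact pro-$p$ entrance if the natural maps identify $\widehat\Gamma_p$ with $\widehat{(H_1)}_p\amalg_{\widehat K_p}\widehat{(H_2)}_p$ as a proper pro-$p$ amalgam: the natural maps $\widehat K_p\to\widehat{(H_i)}_p$ are injective, the resulting pro-$p$ amalgam is proper, and the natural map from it to $\widehat\Gamma_p$ is an isomorphism. *)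

(* Defs.v *)
From HB Require Import structures.
From mathcomp Require Import all_boot all_order all_algebra.
From mathcomp Require Import all_classical all_reals.
From mathcomp Require Import topology function_spaces separation_axioms.

Set Implicit Arguments.
Unset Strict Implicit.
Unset Printing Implicit Defensive.

Local Open Scope classical_set_scope.
Local Open Scope card_scope.
Local Open Scope group_scope.

Section AbstractGroups.
Variable G : groupType.
Implicit Types (N A B : set G) (g x y : G).

Definition subgroup N : Prop :=
  [/\ N 1, (forall x y, N x -> N y -> N (x * y)) & (forall x, N x -> N x^-1)].

Definition normal_subgroup N : Prop :=
  subgroup N /\ forall x y, N x -> N (x ^ y).

Definition left_coset g N : set G := [set g * n | n in N].

Definition has_index N (n : nat) : Prop :=
  range (fun g => left_coset g N) #= `I_n.

(* G / N is a finite p-group *)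
Definition p_power_normal (p : nat) N : Prop :=
  normal_subgroup N /\ exists2 n, has_index N n & p.-nat n.

Definition mul_set A B : set G := [set x * y | x in A & y in B].
Definition inv_set A : set G := [set x^-1 | x in A].

Definition cyclic_subgroup g : set G :=
  range (fun n : nat => g ^+ n) `|` range (fun n : nat => g ^- n).

End AbstractGroups.

Definition group_hom (G H : groupType) (f : G -> H) : Prop :=
  {morph f : x y / x * y}.

(* G = H1 *_K H2 : the pushout, in groups, of two injective homomorphisms. *)
Definition amalgamated_free_product (K H1 H2 G : groupType)
    (i1 : K -> H1) (i2 : K -> H2) (j1 : H1 -> G) (j2 : H2 -> G) : Prop :=
  [/\ group_hom i1 /\ group_hom i2, injective i1 /\ injective i2,
      group_hom j1 /\ group_hom j2, j1 \o i1 = j2 \o i2 &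
      forall (T : groupType) (t1 : H1 -> T) (t2 : H2 -> T),
        group_hom t1 -> group_hom t2 -> t1 \o i1 = t2 \o i2 ->
        exists! u : G -> T, [/\ group_hom u, u \o j1 = t1 & u \o j2 = t2]].

HB.mixin Record Group_Topological_isTopologicalGroup G
    of Group G & Topological G := {
  mulg_continuous : continuous (fun x : G * G => x.1 * x.2) ;
  invg_continuous : continuous (fun x : G => x^-1)
}.

#[short(type="topologicalGroupType")]
HB.structure Definition TopologicalGroup :=
  {G of Group G & Topological G & Group_Topological_isTopologicalGroup G}.

Definition profinite (G : topologicalGroupType) : Prop :=
  [/\ compact [set: G], hausdorff_space G & totally_disconnected [set: G]].

Definition pro_p (p : nat) (G : topologicalGroupType) : Prop :=
  profinite G /\
  forall N : set G, open N -> normal_subgroup N -> p_power_normal p N.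

Definition boundedly_generated (G : topologicalGroupType) : Prop :=
  exists (d : nat) (g : 'I_d -> G), forall x : G,
    exists2 y : 'I_d -> G,
      forall i, closure (cyclic_subgroup (g i)) (y i) & x = \prod_(i < d) y i.

Definition continuous_hom (G H : topologicalGroupType) (f : G -> H) : Prop :=
  group_hom f /\ continuous f.

Definition topological_iso (G H : topologicalGroupType) (f : G -> H) : Prop :=
  continuous_hom f /\
  exists g : H -> G, [/\ continuous_hom g, cancel f g & cancel g f].

(* (P, k1, k2) is the pushout G1 <- A -> G2 in the category of pro-p groups. *)
Definition pro_p_pushout (p : nat) (A G1 G2 P : topologicalGroupType)
    (f1 : A -> G1) (f2 : A -> G2) (k1 : G1 -> P) (k2 : G2 -> P) : Prop :=
  [/\ pro_p p P, continuous_hom k1, continuous_hom k2, k1 \o f1 = k2 \o f2 &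
      forall (T : topologicalGroupType) (t1 : G1 -> T) (t2 : G2 -> T),
        pro_p p T -> continuous_hom t1 -> continuous_hom t2 ->
        t1 \o f1 = t2 \o f2 ->
        exists! u : P -> T, [/\ continuous_hom u, u \o k1 = t1 & u \o k2 = t2]].

(** The pro-p completion: the inverse limit of the quotients G / N over the
    normal subgroups N of p-power index. A point assigns to each such N an
    element of G / N, i.e. a left coset of N, compatibly with the projections
    G / N -> G / M for N contained in M; the topology is induced by the product
    of the discrete spaces G / N. *)
Section Completion.
Variables (p : nat) (G : groupType).

Definition p_quotient := {N : set G | p_power_normal p N}.

HB.instance Definition _ := gen_eqMixin p_quotient.
HB.instance Definition _ := gen_choiceMixin p_quotient.

Record completion := Completion {
  component : p_quotient -> set G ;
  componentP : forall N, exists g, component N = left_coset g (sval N) ;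
  component_compat : forall N M, sval N `<=` sval M ->
    component N `<=` component M
}.

Lemma completion_ext (x y : completion) : component x =1 component y -> x = y.
Proof.
case: x y => [x xP xc] [y yP yc] /= /funext xy; subst y.
by congr Completion; exact: Prop_irrelevance.
Qed.

Lemma left_cosetE (N : set G) g x : left_coset g N x <-> N (g^-1 * x).
Proof.
split=> [[n Nn <-]|Nx]; first by rewrite mulKg.
by exists (g^-1 * x) => //; rewrite mulVKg.
Qed.

Lemma mul_left_coset (N : set G) g h : normal_subgroup N ->
  mul_set (left_coset g N) (left_coset h N) = left_coset (g * h) N.
Proof.
move=> [[N1 NM NV] NJ]; apply/seteqP; split=> x.
  move=> [_ [n Nn <-] [_ [m Nm <-] <-]]; exists (n ^ h * m).
    by apply: NM => //; exact: NJ.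
  by rewrite conjgE !mulgA mulgK.
move=> [n Nn <-]; exists (g * 1); first by exists 1.
by exists (h * n); [exists n | rewrite mulg1 mulgA].
Qed.

Lemma inv_left_coset (N : set G) g : normal_subgroup N ->
  inv_set (left_coset g N) = left_coset g^-1 N.
Proof.
move=> [[N1 NM NV] NJ]; apply/seteqP; split=> x.
  move=> [_ [n Nn <-] <-]; apply/left_cosetE; rewrite invgM.
  have := NJ _ g^-1 (NV _ Nn).
  by rewrite conjgE !invgK.
move=> /left_cosetE; rewrite invgK => Ngx; exists x^-1; last exact: invgK.
apply/left_cosetE.
have := NJ _ g (NV _ Ngx); rewrite conjgE invgM => h.
by move: h; rewrite !mulgA mulgVK.
Qed.

Lemma left_coset1 (N : set G) : left_coset 1 N = N.
Proof.
by apply/seteqP; split=> x; rewrite left_cosetE invg1 mul1g.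
Qed.

Lemma p_quotient_normal (N : p_quotient) : normal_subgroup (sval N).
Proof. by case: N => N []. Qed.

Fact canonical_compat g (N M : p_quotient) : sval N `<=` sval M ->
  left_coset g (sval N) `<=` left_coset g (sval M).
Proof. by move=> NM x [n Nn <-]; exists n => //; exact: NM. Qed.

(* the canonical homomorphism G -> completion *)
Definition canonical (g : G) : completion := Completion
  (fun N : p_quotient => ex_intro _ g erefl) (@canonical_compat g).

Fact mul_componentP (x y : completion) (N : p_quotient) :
  exists g, mul_set (component x N) (component y N) = left_coset g (sval N).
Proof.
have [g ->] := componentP x N; have [h ->] := componentP y N.
by exists (g * h); apply: mul_left_coset; exact: p_quotient_normal.
Qed.

Fact mul_component_compat (x y : completion) (N M : p_quotient) :
  sval N `<=` sval M ->
  mul_set (component x N) (component y N) `<=`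
  mul_set (component x M) (component y M).
Proof.
move=> NM z [a xa [b yb <-]]; exists a; first exact: component_compat xa.
by exists b => //; exact: component_compat yb.
Qed.

Fact inv_componentP (x : completion) (N : p_quotient) :
  exists g, inv_set (component x N) = left_coset g (sval N).
Proof.
have [g ->] := componentP x N.
by exists g^-1; apply: inv_left_coset; exact: p_quotient_normal.
Qed.

Fact inv_component_compat (x : completion) (N M : p_quotient) :
  sval N `<=` sval M -> inv_set (component x N) `<=` inv_set (component x M).
Proof. by move=> NM z [a xa <-]; exists a => //; exact: component_compat xa. Qed.

Definition completion_one := canonical 1.
Definition completion_mul x y :=
  Completion (mul_componentP x y) (@mul_component_compat x y).
Definition completion_inv x :=
  Completion (inv_componentP x) (@inv_component_compat x).

HB.instance Definition _ := gen_eqMixin completion.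
HB.instance Definition _ := gen_choiceMixin completion.

Fact completion_mulA : associative completion_mul.
Proof.
move=> x y z; apply: completion_ext => N /=.
have [a ->] := componentP x N; have [b ->] := componentP y N.
have [c ->] := componentP z N; have nN := p_quotient_normal N.
by rewrite !mul_left_coset // mulgA.
Qed.

Fact completion_mul1 : left_id completion_one completion_mul.
Proof.
move=> x; apply: completion_ext => N /=.
have [a ->] := componentP x N; have nN := p_quotient_normal N.
by rewrite !mul_left_coset // mul1g.
Qed.

Fact completion_mulr1 : right_id completion_one completion_mul.
Proof.
move=> x; apply: completion_ext => N /=.
have [a ->] := componentP x N; have nN := p_quotient_normal N.
by rewrite !mul_left_coset // mulg1.
Qed.

Fact completion_mulV :
  left_inverse completion_one completion_inv completion_mul.
Proof.
move=> x; apply: completion_ext => N /=.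
have [a ->] := componentP x N; have nN := p_quotient_normal N.
by rewrite inv_left_coset // mul_left_coset // mulVg.
Qed.

Fact completion_mulrV :
  right_inverse completion_one completion_inv completion_mul.
Proof.
move=> x; apply: completion_ext => N /=.
have [a ->] := componentP x N; have nN := p_quotient_normal N.
by rewrite inv_left_coset // mul_left_coset // mulgV.
Qed.

HB.instance Definition _ := isGroup.Build completion completion_mulA
  completion_mul1 completion_mulr1 completion_mulV completion_mulrV.

Definition components (x : completion) :
    prod_topology (fun _ : p_quotient => discrete_topology (set G)) :=
  component x.

HB.instance Definition _ :=
  Topological.copy completion (initial_topology components).

End Completion.

Section CompletionTopology.
Variables (p : nat) (G : groupType).
Local Notation Gp := (completion p G).

Lemma nbhs_component (x : Gp) (N : p_quotient p G) :
  nbhs x [set y | component y N = component x N].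
Proof.
have pc := @proj_continuous _
  (fun _ : p_quotient p G => discrete_topology (set G)) N.
have c := continuous_comp (@initial_continuous _ _ (@components p G) x) (pc _).
exact: (c _ (discrete_set1 (component x N : discrete_topology (set G)))).
Qed.

Lemma completion_continuous (T : topologicalType) (f : T -> Gp) :
  (forall t N, nbhs t [set s | component (f s) N = component (f t) N]) ->
  continuous f.
Proof.
move=> H; apply: continuous_comp_initial => t.
apply/cvg_sup => N U [_ [[V oV <-]] Vt VU].
apply: filterS (H t N) => s /= e; apply: VU => /=.
by rewrite /components e.
Qed.

Fact completion_mul_continuous : continuous (fun x : Gp * Gp => x.1 * x.2).
Proof.
apply: completion_continuous => -[x y] N.
exists ([set z | component z N = component x N],
        [set z | component z N = component y N]).
  by split; exact: nbhs_component.
by move=> [z t] /= [-> ->].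
Qed.

Fact completion_inv_continuous : continuous (fun x : Gp => x^-1).
Proof.
apply: completion_continuous => x N.
by apply: filterS (nbhs_component x N) => z /= ->.
Qed.

HB.instance Definition _ := Group_Topological_isTopologicalGroup.Build
  (completion p G) completion_mul_continuous completion_inv_continuous.

End CompletionTopology.

Section Functoriality.
Variables (p : nat) (G H : groupType) (f : {multiplicative G -> H}).

Fact hom1 : f 1 = 1.
Proof. by apply: (@mulIg _ (f 1)); rewrite -gmulfM !mul1g. Qed.

Fact homV x : f x^-1 = (f x)^-1.
Proof. by apply: (@mulIg _ (f x)); rewrite -gmulfM !mulVg hom1. Qed.

Lemma preimage_normal (N : set H) :
  normal_subgroup N -> normal_subgroup (f @^-1` N).
Proof.
move=> [[N1 NM NV] NJ]; split; first split => /=.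
- by rewrite hom1.
- by move=> x y Nx Ny; rewrite gmulfM; exact: NM.
- by move=> x Nx; rewrite homV; exact: NV.
- by move=> x y Nx /=; rewrite !conjgE !gmulfM homV; exact: NJ.
Qed.

Lemma left_coset_eq (K : groupType) (N : set K) x y : normal_subgroup N ->
  left_coset x N = left_coset y N <-> N (x^-1 * y).
Proof.
move=> [[N1 NM NV] _]; split=> [e|Nxy].
  have : left_coset y N y by apply/left_cosetE; rewrite mulVg.
  by rewrite -e => /left_cosetE.
apply/seteqP; split=> z /left_cosetE h; apply/left_cosetE.
  have := NM _ _ (NV _ Nxy) h.
  by rewrite invgM invgK -!mulgA mulVKg.
by have := NM _ _ Nxy h; rewrite -!mulgA mulVKg.
Qed.



Lemma eq_card_range (T U V : Type) (a : T -> U) (b : T -> V) :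
  (forall x y, a x = a y <-> b x = b y) -> range a #= range b.
Proof.
move=> ab.
have [h hP] : {h : range a -> range b &
    forall u, exists t, a t = val u /\ b t = val (h u)}.
  apply: (@choice _ _ (fun (u : range a) (v : range b) =>
    exists t, a t = val u /\ b t = val v)) => -[u ua] /=.
  have [t _ tu] := set_mem ua.
  have bt : range b (b t) by exists t.
  by exists (SigSub (mem_set bt)), t.
have [g gP] : {g : range b -> range a &
    forall v, exists t, b t = val v /\ a t = val (g v)}.
  apply: (@choice _ _ (fun (v : range b) (u : range a) =>
    exists t, b t = val v /\ a t = val u)) => -[v vb] /=.
  have [t _ tv] := set_mem vb.
  have at_ : range a (a t) by exists t.
  by exists (SigSub (mem_set at_)), t.
apply/card_bijP; exists h; exists g => [u|v]; apply: val_inj.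
  have [t [<- e]] := hP u; have [s [e' <-]] := gP (h u).
  by apply/ab; rewrite e'.
have [t [<- e]] := gP v; have [s [e' <-]] := hP (g v).
by apply/ab; rewrite e'.
Qed.

Lemma card_eq_finset (n : nat) (A : {set 'I_n}) : [set` A] #= `I_#|A|.
Proof.
have -> : [set` A] = range (@enum_val _ (mem A)).
  apply/seteqP; split=> [x /= xA|_ [i _ <-]]; last exact: enum_valP.
  by exists (enum_rank_in xA x) => //; rewrite enum_rankK_in.
rewrite (card_eql (@eq_card_range _ _ _ _ id _)) ?image_id.
  by rewrite card_eq_sym; exact: card_II.
by move=> x y; split=> [/enum_val_inj|->].
Qed.

(* [G : f^-1 N] is the common size of the classes of a partition of H / N,
   hence divides [H : N]. *)
Lemma preimage_p_power (N : set H) :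
  p_power_normal p N -> p_power_normal p (f @^-1` N).
Proof.
move=> [nN [n /card_set_bijP[/= b [bI binj bsurj]] pn]].
have nM := preimage_normal nN; split => //.
have phiP x : (b (left_coset x N) < n)%N by apply: bI; exists x.
pose phi x : 'I_n := Ordinal (phiP x).
have phiE x y : phi x = phi y <-> N (x^-1 * y).
  rewrite -left_coset_eq //; split=> [/(congr1 val) /= e|e].
    by apply: binj => //; apply/mem_set; [exists x | exists y].
  by apply: val_inj; rewrite /= e.
have [r rP] : {r : 'I_n -> H & forall c, phi (r c) = c}.
  apply: (@choice _ _ (fun (c : 'I_n) h => phi h = c)) => c.
  have [_ [x _ <-] e] := bsurj c (ltn_ord c).
  by exists x; apply: val_inj.
pose h (c : 'I_n) (g : G) : 'I_n := phi (f g * r c).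
pose S (c : 'I_n) : {set 'I_n} := finset (fun d => `[< exists g, h c g = d >]).
have SE c : [set` S c] = range (h c).
  apply/seteqP; split=> d /=; rewrite inE.
    by move=> /asboolP[g <-]; exists g.
  by case=> g _ <-; apply/asboolP; exists g.
have hE c g g' : h c g = h c g' <-> N (f (g^-1 * g')).
  rewrite phiE invgM -mulgA (mulgA _ (f g')) -homV -gmulfM.
  have [_ NJ] := nN; rewrite -conjgE; split=> [h1|]; last exact: NJ.
  by have := NJ _ (r c)^-1 h1; rewrite conjgK.
have Sindex c : has_index (f @^-1` N) #|S c|.
  rewrite /has_index -(card_eqr (card_eq_finset (S c))) SE.
  by apply: eq_card_range => g g'; rewrite hE left_coset_eq.
have Scard c d : #|S c| = #|S d|.
  apply/card_eq_II; rewrite -(card_eql (Sindex c)); exact: Sindex.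
have SP c d : reflect (exists g, N ((f g * r c)^-1 * r d)) (d \in S c).
  rewrite inE; apply: (iffP (asboolP _)) => -[g e]; exists g.
    by apply/phiE; rewrite rP.
  by rewrite -[RHS]rP; apply/phiE.
have [[N1 NM NV] _] := nN.
have Srefl c : c \in S c.
  by apply/SP; exists 1; rewrite hom1 mul1g mulVg.
have Ssym c d : d \in S c -> c \in S d.
  move=> /SP[g /NV Ng]; apply/SP; exists g^-1.
  by move: Ng; rewrite homV !invgM !invgK mulgA.
have Strans c d e : d \in S c -> e \in S d -> e \in S c.
  move=> /SP[g Ng] /SP[g' Ng']; apply/SP; exists (g' * g).
  have := NM _ _ Ng Ng'.
  by rewrite gmulfM !invgM -!mulgA mulVKg.
have Req : {in [set: 'I_n]%SET & &, equivalence_rel (fun c d => d \in S c)}.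
  move=> c d e _ _ _; split=> // cd.
  by apply/idP/idP => [|/(Strans _ _ _ cd)//]; apply: Strans; exact: Ssym.
have partS := equivalence_partitionP Req.
have n_gt0 : (0 < n)%N by have := phiP 1; case: (n).
pose c0 := Ordinal n_gt0.
have unif : {in equivalence_partition (fun c d => d \in S c) [set: 'I_n]%SET,
    forall A : {set 'I_n}, #|A| = #|S c0|}.
  move=> A /imsetP[c _ ->]; rewrite (Scard c0 c); apply: eq_card => d.
  by rewrite !inE.
have := card_uniform_partition unif partS; rewrite cardsT card_ord => nE.
exists #|S c0|; first exact: Sindex.
by apply: pnat_dvd pn; apply/dvdnP; eexists; exact: nE.
Qed.


Definition pullback (N : p_quotient p H) : p_quotient p G :=
  exist _ (f @^-1` sval N) (preimage_p_power (svalP N)).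

Lemma image_left_coset g (N : set H) : normal_subgroup N ->
  mul_set (f @` left_coset g (f @^-1` N)) N = left_coset (f g) N.
Proof.
move=> [[N1 NM NV] _]; apply/seteqP; split=> x.
  move=> [_ [_ [n Nn <-] <-] [m Nm <-]]; rewrite gmulfM -mulgA.
  by exists (f n * m) => //; exact: NM.
move=> [n Nn <-]; exists (f g) => //; last by exists n.
by exists g => //; exists 1; rewrite ?mulg1 //= hom1.
Qed.

Fact map_componentP (x : completion p G) (N : p_quotient p H) : exists h,
  mul_set (f @` component x (pullback N)) (sval N) = left_coset h (sval N).
Proof.
have [g ->] := componentP x (pullback N); exists (f g).
by apply: image_left_coset; exact: p_quotient_normal.
Qed.

Fact map_component_compat (x : completion p G) (N M : p_quotient p H) :
  sval N `<=` sval M ->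
  mul_set (f @` component x (pullback N)) (sval N) `<=`
  mul_set (f @` component x (pullback M)) (sval M).
Proof.
move=> NM _ [_ [a xa <-] [b Nb <-]]; exists (f a).
  exists a => //; apply: component_compat xa => y; exact: NM.
by exists b => //; exact: NM.
Qed.

(* The homomorphism of completions induced by f: a coset g f^-1(N) is sent to
   f(g) N. *)
Definition completion_map (x : completion p G) : completion p H :=
  Completion (map_componentP x) (@map_component_compat x).

Lemma completion_map_hom : continuous_hom completion_map.
Proof.
split=> [x y|].
  apply: completion_ext => N /=; have nN := p_quotient_normal N.
  have nM := p_quotient_normal (pullback N).
  have [a ->] := componentP x (pullback N).
  have [b ->] := componentP y (pullback N).
  by rewrite mul_left_coset // !image_left_coset // mul_left_coset // gmulfM.
apply: completion_continuous => x N.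
by apply: filterS (nbhs_component x (pullback N)) => z /= ->.
Qed.

Lemma completion_map_canonical (g : G) :
  completion_map (canonical p g) = canonical p (f g).
Proof.
apply: completion_ext => N /=; apply: image_left_coset.
exact: p_quotient_normal.
Qed.

End Functoriality.

Arguments completion_map p {G H} f x.

Definition proper_pro_p_amalgam (p : nat) (A G1 G2 P : topologicalGroupType)
    (f1 : A -> G1) (f2 : A -> G2) (k1 : G1 -> P) (k2 : G2 -> P) : Prop :=
  [/\ pro_p_pushout p f1 f2 k1 k2, injective k1 & injective k2].

Definition exact_pro_p_entrance (p : nat) (K H1 H2 G : groupType)
    (i1 : {multiplicative K -> H1}) (i2 : {multiplicative K -> H2})
    (j1 : {multiplicative H1 -> G}) (j2 : {multiplicative H2 -> G}) : Prop :=
  [/\ injective (completion_map p i1), injective (completion_map p i2) &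
      exists (P : topologicalGroupType)
             (k1 : completion p H1 -> P) (k2 : completion p H2 -> P),
        proper_pro_p_amalgam p (completion_map p i1) (completion_map p i2)
          k1 k2 /\
        exists u : P -> completion p G,
          [/\ topological_iso u, u \o k1 = completion_map p j1 &
              u \o k2 = completion_map p j2]].

(* Main.v *)
From HB Require Import structures.
Require Import Defs.
From mathcomp Require Import all_classical all_reals.
From mathcomp Require Import topology function_spaces separation_axioms.
From mathcomp Require Import all_boot all_order all_algebra.
From mathcomp Require Import all_fingroup all_solvable.

Set Implicit Arguments.
Unset Strict Implicit.
Unset Printing Implicit Defensive.

(** Let Q be a finite p-quotient of Gamma and let X, Y and C be the images in
    Q of H1, H2 and K.  The theorem is proved by looking at such quotients only.
    The pro-p completion of a group is boundedly generated exactly when, for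
    one d, all finite p-quotients of the group are products of d cyclic groups
    ([bounded_mod_of_completion], [completion_of_bounded_mod]).  Exactness of
    the entrance is used through the injectivity of the maps between the
    completions; by compactness ([separation]) it makes the finite p-quotients
    of Gamma fine enough: finitely many cosets of A in G_1 or in G_2 stay
    distinct in a suitable Q, and every finite p-quotient of K is a quotient of
    a suitable C.

    The indices are 2.  A product of d cyclic groups of exponent p^e has order
    at most p^(e d).  Against this, let Q act on the F_p-space M with basis
    Q / C, and let m be the basis vector C.  Since C fixes m, conjugating the
    image of H1 by m in the semidirect product of M and Q, and keeping that of
    H2, gives another finite quotient of Gamma.  It maps onto Q, its exponent
    is at most p times larger, and the kernel to Q contains the first homology
    of the graph with edges Q / C and vertices Q / X and Q / Y, which is the
    quotient of the Bass-Serre tree by the kernel of the map from Gamma to Q.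
    The dimension of this homology is at least |Q : C| - |Q : X| - |Q : Y|
    ([growth_step]).  Unless |X : C| and |Y : C| are both 2 (or one of them is
    1), this is at least a constant multiple of |Q|, so that repeating the step
    makes log |Q| grow exponentially while the exponent p^e only allows linear
    growth ([amalgam_index_bound]).  Hence A has index 2 in G_1 and in G_2, and
    p = 2 because 2 divides the order of a p-group.

    A is boundedly generated.  Now p = 2 and Q / C is generated by two
    involutions, so its squares lie in a cyclic subgroup.  Let W be generated
    by the 2^(s+1)-th powers of Q and let N be the intersection of C and W,
    with s large in terms of d.  Already 2^s-th powers centralize the normal
    elementary abelian sections of Q of order at most 2^(2^s)
    ([pow2_cent_abelem]).  Therefore N has few generators, since otherwise Q
    would have an elementary abelian section too large for a product of d
    cyclic groups ([Phi_index_bound]); and then N is powerful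
    ([powerful_of_Mho]), hence the product of the cyclic groups generated by its
    generators ([powerful_span]).  As |C : N| is bounded, C is a product of a
    bounded number of cyclic groups ([normal_cyclic_span]).

    Conversely, if both indices are 2 then Q / C, being generated by two
    involutions, is a product of two cyclic groups, so that Q needs only two
    more cyclic factors than C ([dihedral_cyclic_span]). *)

Local Open Scope group_scope.

(** * Products of cyclic groups and actions on elementary abelian 2-groups *)

Section CyclicSpan.
Variable gT : finGroupType.
Implicit Types (l : seq gT) (G : {group gT}).

Definition cyclic_span l : {set gT} := \prod_(a <- l) <[a]>.

Lemma cyclic_span_cat l1 l2 :
  cyclic_span (l1 ++ l2) = cyclic_span l1 * cyclic_span l2.
Proof. by rewrite /cyclic_span big_cat. Qed.

Lemma cyclic_span_sub l G : {subset l <= G} -> cyclic_span l \subset G.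
Proof.
move=> lG; rewrite /cyclic_span big_seq.
elim/big_rec: _ => [|a B al BG]; first exact: sub1G.
by rewrite mul_subG // cycle_subG lG.
Qed.

Lemma cyclic_span1 l : 1 \in cyclic_span l.
Proof.
rewrite /cyclic_span; elim/big_rec: _ => [|a B _ B1]; first exact: set11.
by rewrite -[1]mulg1 mem_mulg.
Qed.

Lemma card_cyclic_span m l : (0 < m)%N -> {in l, forall a, a ^+ m = 1} ->
  (#|cyclic_span l| <= m ^ size l)%N.
Proof.
move=> m0; rewrite /cyclic_span; elim: l => [|a l IHl] lm.
  by rewrite big_nil cards1.
rewrite big_cons expnS; apply: (@leq_trans (#|<[a]>| * #|cyclic_span l|)%N).
  rewrite -/(cyclic_span l) /mulg /= /set_mulg curry_imset2X -cardsX.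
  exact: leq_imset_card.
apply: leq_mul; last by apply: IHl => b bl; apply: lm; rewrite inE bl orbT.
by rewrite -orderE dvdn_leq // order_dvdn lm ?inE ?eqxx.
Qed.

End CyclicSpan.

Lemma quotient_cyclic_span (gT : finGroupType) (H : {group gT}) (l : seq gT) :
  {subset l <= 'N(H)} -> cyclic_span l / H = cyclic_span (map (coset H) l).
Proof.
rewrite /cyclic_span; elim: l => [|a l IHl] lN; first by rewrite !big_nil quotient1.
have aN : a \in 'N(H) by rewrite lN ?inE ?eqxx.
rewrite /= !big_cons quotientMl ?cycle_subG // IHl ?quotient_cycle //.
by move=> b bl; rewrite lN // inE bl orbT.
Qed.

Section Actions.
Variable gT : finGroupType.
Implicit Types (P E H : {group gT}).

(** In additive notation q^2 - 1 = (q - 1)^2 on a module of characteristic 2. *)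
Lemma commg_sqr_abelem E e q : 2.-abelem E -> q \in 'N(E) -> e \in E ->
  [~ e, q ^+ 2] = [~ [~ e, q], q].
Proof.
move=> aE qN eE.
have fE : [~ e, q] \in E by rewrite commgEl groupM ?groupV // memJ_norm.
have e2 : [~ e, q] * [~ e, q] = 1.
  by rewrite -expg2; case/(abelemP (isT : prime 2)): aE => _ ->.
by rewrite expg2 commgMJ -[_ ^ q](mulKVg [~ e, q]) -commgEl mulgA e2 mul1g.
Qed.

Lemma commg_pow2_abelem E s e q : 2.-abelem E -> q \in 'N(E) -> e \in E ->
  [~ e, q ^+ (2 ^ s)] = iter (2 ^ s) (fun a => [~ a, q]) e.
Proof.
move=> aE; elim: s q => [|s IHs] q qN eE //.
rewrite expnS expgM IHs ?groupX //.
have iterE m : iter (2 * m) (fun a => [~ a, q]) e \in E /\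
    iter m (fun a => [~ a, q ^+ 2]) e = iter (2 * m) (fun a => [~ a, q]) e.
  elim: m => [//|m [mE IHm]].
  have E1 a : a \in E -> [~ a, q] \in E.
    by move=> aE'; rewrite commgEl groupM ?groupV // memJ_norm.
  rewrite mulnS /= IHm; split; first by exact: (E1 _ (E1 _ mE)).
  by rewrite (commg_sqr_abelem aE).
by have [_ ->] := iterE (2 ^ s)%N.
Qed.

(** Commutation with q maps H into [H, q], which is smaller by a factor of at
    least 2 because P is nilpotent. *)
Lemma iter_commg_nil P H n e q : nilpotent P -> q \in P -> H \subset P ->
  q \in 'N(H) -> (#|H| <= 2 ^ n)%N -> e \in H ->
  iter n (fun a => [~ a, q]) e = 1.
Proof.
move=> nilP qP; elim: n H e => [|n IHn] H e HP qN Hn eH.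
  apply/set1gP; suff <- : H :=: 1 by [].
  by apply/eqP; rewrite trivg_card_le1.
have f1 m : iter m (fun a => [~ a, q]) 1 = 1.
  by elim: m => //= m ->; rewrite comm1g.
have [H1|ntH] := eqVneq (H : {set gT}) 1.
  by move: eH; rewrite H1 => /set1gP->.
rewrite iterSr; apply: (IHn [~: H, <[q]> ]%G).
- by rewrite (subset_trans _ HP) // commg_subl cycle_subG.
- by rewrite -cycle_subG commg_normr.
- have pr : [~: H, <[q]> ] \proper H.
    apply: (nil_comm_properl nilP) => //.
    by rewrite subsetI !cycle_subG qP.
  have i1 : (1 < #|H : [~: H, <[q]> ]|)%N.
    by rewrite indexg_gt1; case/andP: pr.
  have LE := Lagrange (proper_sub pr).
  rewrite -(leq_pmul2r (isT : 0 < 2)%N) -expnSr (leq_trans _ Hn) // -LE.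
  by rewrite leq_mul2l i1 orbT.
- by rewrite mem_commg // cycle_id.
Qed.

(** The operator q - 1 on E is nilpotent of order at most log |E| <= 2^s, and
    its 2^s-th power is q^(2^s) - 1.  The exponent s is only doubly logarithmic
    in |E|, which is what makes the estimates below consistent. *)
Lemma pow2_cent_abelem P E s q : 2.-group P -> E \subset P -> 2.-abelem E ->
  q \in P -> q \in 'N(E) -> (#|E| <= 2 ^ (2 ^ s))%N -> q ^+ (2 ^ s) \in 'C(E).
Proof.
move=> pP EP aE qP qN Es; apply/centP => e eE; apply/commute_sym/commgP.
rewrite (commg_pow2_abelem _ aE) //.
by rewrite (iter_commg_nil (pgroup_nil pP) qP EP qN Es eE).
Qed.

End Actions.

(** * Powerful 2-groups *)
Lemma expg2_mul (gT : groupType) (x y : gT) :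
  (x * y) ^+ 2 = x ^+ 2 * y ^+ 2 * [~ y, x] ^ y.
Proof. by rewrite commgEl !conjgE !expg2 !mulgA !mulgK. Qed.

Section LowerSeries.
Variable gT : finGroupType.
Implicit Types (G H : {group gT}).

(** The lower exponent-2 central series, numbered from [lower2 0 G = G].  A
    2-group is treated as powerful when its derived group lies in [lower2 2 G]
    (the usual definition asks for the subgroup of fourth powers): this is all
    that the cyclic factorization needs, and it is easy to establish. *)
Fixpoint lower2 n G : {group gT} :=
  if n is m.+1 then ('Mho^1(lower2 m G) <*> [~: lower2 m G, G])%G else G.

Lemma lower2_char n G : lower2 n G \char G.
Proof.
elim: n => [|n IHn] /=; first exact: char_refl.
by rewrite charY ?charR ?char_refl // (char_trans (Mho_char _ _)).
Qed.

Lemma lower2_normal n G : lower2 n G <| G.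
Proof. exact/char_normal/lower2_char. Qed.

Lemma lower2_subS n G : lower2 n.+1 G \subset lower2 n G.
Proof.
by rewrite /= join_subG Mho_sub commg_subl; case/andP: (lower2_normal n G).
Qed.

Lemma sqr_lower2 n G x : 2.-group G -> x \in lower2 n G ->
  x ^+ 2 \in lower2 n.+1 G.
Proof.
move=> pG xL; apply: (subsetP (joing_subl _ _)).
apply: (Mho_p_elt 1) => //; apply: mem_p_elt xL.
exact: pgroupS (normal_sub (lower2_normal n G)) pG.
Qed.

Lemma commg_lower2 n G x y : x \in lower2 n G -> y \in G ->
  [~ x, y] \in lower2 n.+1 G.
Proof. by move=> xL yG; apply: (subsetP (joing_subr _ _)); apply: mem_commg. Qed.

(** L = lower2 n G is not [L, G] because G is nilpotent, and L / [L, G] is a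
    nontrivial abelian 2-group, hence is not generated by its squares. *)
Lemma lower2_proper n G : 2.-group G -> lower2 n G :!=: 1 ->
  lower2 n.+1 G \proper lower2 n G.
Proof.
move=> pG ntL; set L := lower2 n G in ntL *.
have nL : L <| G by exact: lower2_normal.
have pL : 2.-group L := pgroupS (normal_sub nL) pG.
have LG := normal_sub nL; have GN := normal_norm nL.
have prK : [~: L, G] \proper L.
  by apply: nil_comm_properl (pgroup_nil pG) LG ntL _; rewrite subsetI subxx.
rewrite properE lower2_subS /= -/L; apply/negP => LM.
pose K := [~: L, G]%G.
have nK : K <| L.
  by rewrite /normal proper_sub //= (subset_trans LG) // commg_normr.
have LKab : abelian (L / K) by rewrite sub_der1_abelian // commgS.
have ntLK : L / K != 1.
  by rewrite -subG1 quotient_sub1 ?normal_norm //; case/andP: prK.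
have := Phi_proper ntLK; rewrite (Phi_Mho (quotient_pgroup K pL)) //.
rewrite -morphim_Mho ?normal_norm // properE => /andP[_ /negP]; apply.
apply: subset_trans (quotientS _ LM) _; rewrite quotientYidr //.
by rewrite (subset_trans (Mho_sub _ _)) ?normal_norm.
Qed.

Lemma lower2_trivial G : 2.-group G -> exists n, lower2 n G :=: 1.
Proof.
move=> pG.
suff H m : (#|lower2 m G| + m <= #|G|)%N \/ exists n, lower2 n G :=: 1.
  case: (H #|G|) => // h; exists 0%N.
  by move: h; rewrite -{3}[#|G|]add0n leq_add2r leqNgt cardG_gt0.
elim: m => [|m [IHm|]]; [by left; rewrite addn0 | | by right].
have [L1|ntL] := eqVneq (lower2 m G : {set gT}) 1; first by right; exists m.
left; apply: leq_trans IHm; rewrite addnS -addSn leq_add2r.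
exact: proper_card (lower2_proper pG ntL).
Qed.

(** By induction on n.  If x lies in the n-th term then a = [x, g] lies two
    terms lower, and [x^2, g] = a^x a = a^2 [a, x]^a; both factors lie in the
    term n + 3. *)
Lemma powerful_lower2 n G : 2.-group G -> [~: G, G] \subset lower2 2 G ->
  [~: lower2 n G, G] \subset lower2 n.+2 G.
Proof.
move=> pG GG; elim: n => [//|n IHn].
set D := lower2 n.+3 G.
have nD : D <| G := lower2_normal _ _; have DN := normal_norm nD.
have LG m : lower2 m G \subset G := normal_sub (lower2_normal m G).
have LN m : lower2 m G \subset 'N(D) := subset_trans (LG m) DN.
rewrite -quotient_cents2 //.
rewrite sub_morphim_pre // [lower2 n.+1 G]/= join_subG.
rewrite (MhoE _ (pgroupS (LG n) pG)) gen_subG; apply/andP; split.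
  apply/subsetP => _ /imsetP[x xL ->].
  have xG := subsetP (LG n) _ xL.
  have x2N : x ^+ (2 ^ 1) \in 'N(D) by rewrite (subsetP DN) // groupX.
  apply/morphpreP; split=> //=; apply/centP => _ /morphimP[g gN gG ->].
  apply/commgP; rewrite -morphR //; apply/eqP/coset_id.
  rewrite expn1 expg2 commMgJ conjg_mulR; set a := [~ x, g].
  have aL : a \in lower2 n.+2 G by apply: (subsetP IHn); apply: mem_commg.
  have aG := subsetP (LG n.+2) _ aL.
  have sqrE (c b : gT) : c * b * c = c ^+ 2 * b ^ c.
    by rewrite expg2 conjgE !mulgA mulgK.
  rewrite sqrE.
  rewrite groupM //; first exact: (@sqr_lower2 n.+2).
  by rewrite memJ_norm ?(subsetP DN) //; exact: (@commg_lower2 n.+2).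
rewrite -sub_morphim_pre; last by rewrite (subset_trans _ DN) // comm_subG.
rewrite quotient_cents2 //; last by rewrite (subset_trans _ DN) // comm_subG.
apply: subset_trans (commSg _ IHn) _; exact: joing_subr.
Qed.

(** Since commutators of elements of the n-th term L lie in the term n + 2,
    squaring is a homomorphism from L modulo that term, and it kills the next
    term; so the squares of generators of L generate the squares of L. *)
Lemma powerful_gen n G (A : {set gT}) : 2.-group G ->
  [~: G, G] \subset lower2 2 G -> G :=: <<A>> ->
  lower2 n G \subset [set a ^+ (2 ^ n) | a in A] <*> lower2 n.+1 G.
Proof.
move=> pG GG GA.
have LG m : lower2 m G \subset G := normal_sub (lower2_normal m G).
have LS m := subsetP (lower2_subS m G).
elim: n => [|n IHn].
  rewrite /= {1}GA gen_subG; apply: subset_trans (joing_subl _ _).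
  by apply/subsetP => a aA; apply/imsetP; exists a.
set J := _ <*> lower2 n.+2 G.
have LJ : lower2 n.+2 G \subset J by exact: joing_subr.
have gS : group_set [set x in lower2 n G | x ^+ 2 \in J].
  apply/group_setP; split=> [|x y]; first by rewrite inE group1 expg1n group1.
  rewrite !inE => /andP[xL xJ] /andP[yL yJ]; rewrite groupM //.
  rewrite expg2_mul.
  apply: groupM; [exact: groupM | apply: (subsetP LJ)].
  have yG := subsetP (LG n) _ yL.
  rewrite memJ_norm ?(subsetP (normal_norm (lower2_normal _ _))) //.
  apply: (subsetP (powerful_lower2 n pG GG)); rewrite mem_commg //.
  exact: (subsetP (LG n)).
have /subsetP SL : lower2 n G \subset Group gS.
  apply: subset_trans IHn _; rewrite join_subG; apply/andP; split.
    apply/subsetP => _ /imsetP[a aA ->]; rewrite inE.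
    apply/andP; split.
      have aG : a \in lower2 0 G by rewrite /= GA mem_gen.
      elim: {J LJ gS} n => [|n IHn] //; rewrite expnSr expgM.
      exact: sqr_lower2.
    apply: (subsetP (joing_subl _ _)); rewrite -expgM -expnSr.
    by apply/imsetP; exists a.
  apply/subsetP => x xL; rewrite inE (LS _ _ xL); apply: (subsetP LJ).
  exact: sqr_lower2.
rewrite [X in X \subset _]/= join_subG (MhoE _ (pgroupS (LG n) pG)) gen_subG.
apply/andP; split; last exact: subset_trans (powerful_lower2 n pG GG) LJ.
apply/subsetP => _ /imsetP[x /SL + ->]; by rewrite inE expn1 => /andP[].
Qed.

(** In the step from n to n + 1 the new factor is, modulo the term n + 1, a
    product of the powers a^(2^n) of the generators.  These are central modulo
    that term, so each of them can be moved into the factor <[a]>. *)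
Lemma powerful_span_mod n G l : 2.-group G ->
  [~: G, G] \subset lower2 2 G -> G :=: <<[set a in l]>> ->
  G \subset cyclic_span l * lower2 n G.
Proof.
move=> pG GG Gl.
have LG m : lower2 m G \subset G := normal_sub (lower2_normal m G).
have lG : {subset l <= G} by move=> a al; rewrite Gl mem_gen // inE.
have lpow a m : a \in l -> a ^+ (2 ^ m) \in lower2 m G.
  move=> al; elim: m => [|m IHm]; first exact: lG.
  by rewrite expnSr expgM; apply: sqr_lower2.
set P := cyclic_span l.
have PG : P \subset G by exact: cyclic_span_sub.
elim: n => [|n IHn].
  by rewrite /= -{1}[gval G]mul1g mulSg // sub1set cyclic_span1.
have nL : lower2 n.+1 G <| G := lower2_normal _ _.
(* the elements that the product absorbs from the right form a group *)
have gS : group_set [set u in G | P * lower2 n.+1 G * [set u] \subset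
                                  P * lower2 n.+1 G].
  apply/group_setP; split=> [|x y]; first by rewrite inE group1 mulg1 subxx.
  rewrite !inE => /andP[xG xP] /andP[yG yP]; rewrite groupM //=.
  by rewrite -mulg_set1 mulgA (subset_trans (mulSg _ xP)).
suff LS : lower2 n G \subset Group gS.
  apply: subset_trans IHn _; apply/subsetP => _ /mulsgP[x u xP /(subsetP LS) + ->].
  rewrite inE => /andP[_ /subsetP]; apply; apply: mem_mulg (set11 u).
  by rewrite -[x]mulg1 mem_mulg.
apply: subset_trans (powerful_gen n pG GG Gl) _.
rewrite join_subG; apply/andP; split; last first.
  apply/subsetP => u uL; rewrite inE (subsetP (LG _) _ uL) /=.
  by rewrite -mulgA mulgS // mul_subG // sub1set.
apply/subsetP => _ /imsetP[a + ->]; rewrite inE => al.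
set b := a ^+ _; have bL : b \in lower2 n G by exact: lpow.
have bG := subsetP (LG n) _ bL; rewrite inE bG /=.
have [l1 [l2 El]] : exists l1 l2, l = l1 ++ a :: l2.
  by case/splitPr: al => l1 l2; exists l1, l2.
have EP : P = cyclic_span l1 * (<[a]> * cyclic_span l2).
  by rewrite /P El cyclic_span_cat /cyclic_span big_cons.
have P2G : cyclic_span l2 \subset G.
  by apply: cyclic_span_sub => x xl; apply: lG; rewrite El mem_cat inE xl !orbT.
rewrite EP; apply/subsetP.
move=> _ /mulsgP[z _ /mulsgP[w v + vL ->] /set1P-> ->].
move=> /mulsgP[x _ xP /mulsgP[c y ca yP ->] ->].
have yG := subsetP P2G _ yP; have vG := subsetP (LG n.+1) _ vL.
have -> : x * (c * y) * v * b = x * ((c * b) * y) * (v * [~ y * v, b]).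
  by rewrite commgEl conjgE !invgM !mulgA !mulgK.
rewrite -invgR mem_mulg ?groupM ?groupV ?commg_lower2 ?groupM //.
by rewrite mem_mulg // mem_mulg // groupM // mem_cycle.
Qed.

Lemma powerful_span G l : 2.-group G ->
  [~: G, G] \subset lower2 2 G -> G :=: <<[set a in l]>> ->
  G \subset cyclic_span l.
Proof.
move=> pG GG Gl; have [n Ln] := lower2_trivial pG.
by have := powerful_span_mod n pG GG Gl; rewrite Ln mulg1.
Qed.

End LowerSeries.

Lemma quotient_Mho (gT : finGroupType) n (G D : {group gT}) :
  G \subset 'N(D) -> 'Mho^n(G) / D = 'Mho^n(G / D).
Proof. exact: morphim_Mho. Qed.

Lemma morphim_lower2 (gT : finGroupType) n (G D : {group gT}) :
  G \subset 'N(D) -> lower2 n G / D = lower2 n (G / D).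
Proof.
move=> GN; elim: n => [//|n IHn] /=.
have LN : lower2 n G \subset 'N(D).
  exact: subset_trans (normal_sub (lower2_normal n G)) GN.
rewrite quotientY ?(subset_trans (Mho_sub _ _)) ?comm_subG //.
by rewrite quotient_Mho // quotientR //= -IHn.
Qed.

Section Powerful.
Variable gT : finGroupType.
Implicit Types (P Q N D : {group gT}) (A : {set gT}).

Lemma card_abelem_gen D A : 2.-abelem D -> D :=: <<A>> -> (#|D| <= 2 ^ #|A|)%N.
Proof.
move=> aD DA; rewrite (card_pgroup (abelem_pgroup aD)) leq_exp2l //.
by rewrite -(rank_abelem aD) -grank_abelian ?(abelem_abelian aD) // DA grank_min.
Qed.

Lemma abelian_quotient_gen D N A : N :=: <<A>> -> D <| N ->
  (forall a b, a \in A -> b \in A -> [~ a, b] \in D) -> [~: N, N] \subset D.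
Proof.
move=> NA /andP[DN ND] AD.
have AN : A \subset N by rewrite NA subset_gen.
rewrite -quotient_cents2 // -/(abelian _) {1}NA quotient_gen ?(subset_trans AN) //.
rewrite abelian_gen; apply/centsP => _ /morphimP[a aN aA ->] _ /morphimP[b bN bA ->].
by apply/commgP; rewrite -morphR //; apply/eqP/coset_id/AD.
Qed.

Lemma sqr_quotient_gen D N A : N :=: <<A>> -> D <| N ->
  [~: N, N] \subset D -> (forall a, a \in A -> a ^+ 2 \in D) ->
  {in N, forall x, x ^+ 2 \in D}.
Proof.
move=> NA /andP[DN ND] ND1 AD.
have gS : group_set [set x in N | x ^+ 2 \in D].
  apply/group_setP; split=> [|x y]; first by rewrite inE group1 expg1n group1.
  rewrite !inE => /andP[xN xD] /andP[yN yD]; rewrite groupM //.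
  rewrite expg2_mul.
  apply: groupM; first exact: groupM.
  by rewrite memJ_norm ?(subsetP ND) // (subsetP ND1) // mem_commg.
have /subsetP NS : N \subset Group gS.
  rewrite {1}NA gen_subG; apply/subsetP => a aA.
  by rewrite inE AD // NA mem_gen.
by move=> x /NS; rewrite inE => /andP[].
Qed.

End Powerful.

(** The crucial case of [powerful_of_Mho], where the subgroup F = [lower2 1 N]
    is central and elementary abelian.  It is generated by the squares and the
    commutators of the generators of N, so that |F| is at most 2^(|A|^2).
    Hence v = q^(2^s) acts trivially on N / F and on F, and then
    [x, v^2] = [x, v]^2 = 1 for x in N.  So all of 'Mho^s.+1(Q), and N in
    particular, centralizes N. *)
Lemma abelian_of_lower2 (gT : finGroupType) (Q N : {group gT}) (A : {set gT}) s :
  2.-group Q -> N <| Q -> N :=: <<A>> ->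
  (#|A| ^ 2 <= 2 ^ s)%N -> N \subset 'Mho^s.+1(Q) -> lower2 2 N :=: 1 ->
  abelian N.
Proof.
move=> pQ nN NA As NW L1.
have [NQ QN] := andP nN; have pN := pgroupS NQ pQ.
set F := lower2 1 N.
have nF : F <| N := lower2_normal 1 N; have FN := normal_sub nF.
have NF := normal_norm nF.
have nFQ : F <| Q := char_normal_trans (lower2_char 1 N) nN.
have AN : A \subset N by rewrite NA subset_gen.
have FC : F \subset 'C(N).
  apply/centsP => x xF y yN; apply/commgP/eqP/set1gP.
  by rewrite -[[1]]/(1 : {set gT}) -L1; exact: (@commg_lower2 _ 1).
have F2 x : x \in F -> x ^+ 2 = 1.
  move=> xF; apply/set1gP; rewrite -L1; exact: (@sqr_lower2 _ 1).
have aF : 2.-abelem F.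
  apply/(abelemP (isT : prime 2)); split=> //.
  exact: subset_trans FC (centS FN).
have NF1 : [~: N, N] \subset F by exact: joing_subr.
have NF2 : {in N, forall x, x ^+ 2 \in F} by move=> x; exact: (@sqr_lower2 _ 0).
(* the squares of the generators are put on the diagonal, where the
   commutators vanish, so that |A|^2 elements suffice *)
pose S := [set (if a == b then a ^+ 2 else [~ a, b]) | a in A, b in A].
have DF : <<S>> \subset F.
  rewrite gen_subG; apply/subsetP => _ /imset2P[a b aA bA ->].
  case: eqP => _; first by rewrite NF2 // (subsetP AN).
  by rewrite (subsetP NF1) // mem_commg // (subsetP AN).
have nD : <<S>> <| N.
  rewrite /normal (subset_trans DF FN) /= cents_norm // centsC.
  exact: subset_trans DF FC.
have FD : F :=: <<S>>.
  apply/eqP; rewrite eqEsubset DF andbT.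
  have ND1 : [~: N, N] \subset <<S>>.
    apply: (abelian_quotient_gen NA nD) => a b aA bA.
    have [->|ab] := eqVneq a b; first by rewrite commgg group1.
    by apply: mem_gen; apply/imset2P; exists a b => //; rewrite (negPf ab).
  rewrite /F /= join_subG ND1 andbT (MhoE _ pN) gen_subG.
  apply/subsetP => _ /imsetP[x xN ->]; rewrite expn1.
  apply: (sqr_quotient_gen NA nD ND1 _ xN) => a aA.
  by apply: mem_gen; apply/imset2P; exists a a; rewrite ?eqxx.
have A2s : (#|A| <= 2 ^ s)%N.
  by apply: leq_trans As; rewrite expnS expn1; case: #|A| => // n; rewrite leq_pmulr.
have cF : (#|F| <= 2 ^ (2 ^ s))%N.
  apply: leq_trans (card_abelem_gen aF FD) _; rewrite leq_exp2l //.
  apply: leq_trans As; rewrite expnS expn1 -cardsX /S curry_imset2X.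
  exact: leq_imset_card.
have aNF : 2.-abelem (N / F).
  apply/(abelemP (isT : prime 2)); split.
    by rewrite /abelian quotient_cents2.
  move=> _ /morphimP[x xNF xN ->]; rewrite -morphX //.
  exact/coset_id/NF2.
have cNF : (#|N / F| <= 2 ^ (2 ^ s))%N.
  have NFA : (N / F)%G :=: <<A / F>>.
    by rewrite -quotient_gen ?(subset_trans AN) // -NA.
  apply: leq_trans (card_abelem_gen aNF NFA) _.
  rewrite leq_exp2l //; apply: leq_trans A2s; exact: leq_quotient.
have QF := normal_norm nFQ.
suff WC : 'Mho^s.+1(Q) \subset 'C(N) by exact: subset_trans NW WC.
rewrite (MhoE _ pQ) gen_subG; apply/subsetP => _ /imsetP[q qQ ->].
have qF : q \in 'N(F) := subsetP QF _ qQ.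
rewrite expnSr expgM; set v := q ^+ _.
have vF : v \in 'C(F).
  by apply: (pow2_cent_abelem pQ) => //; exact: normal_sub.
have vN : coset F v \in 'C(N / F).
  rewrite /v morphX //; apply: (pow2_cent_abelem (quotient_pgroup F pQ)) => //.
  - exact: quotientS.
  - exact: mem_quotient.
  - by rewrite (subsetP (quotient_norms _ QN)) // mem_quotient.
apply/centP => x xN; apply/commute_sym/commgP; rewrite expg2 commgMJ.
have xvF : [~ x, v] \in F.
  have xF : x \in 'N(F) := subsetP NF _ xN.
  have vFn : v \in 'N(F) by rewrite groupX.
  apply: coset_idr; first by rewrite groupR.
  by rewrite morphR //; apply/eqP/commgP/commute_sym/(centP vN)/mem_quotient.
have -> : [~ x, v] ^ v = [~ x, v].
  by apply/conjg_fixP/commgP/commute_sym/(centP vF).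
by rewrite -expg2 F2.
Qed.

Lemma powerful_of_Mho (gT : finGroupType) (Q N : {group gT}) (A : {set gT}) s :
  2.-group Q -> N <| Q -> N :=: <<A>> ->
  (#|A| ^ 2 <= 2 ^ s)%N -> N \subset 'Mho^s.+1(Q) ->
  [~: N, N] \subset lower2 2 N.
Proof.
move=> pQ nN NA As NW; set D := lower2 2 N.
have nD : D <| N := lower2_normal _ _; have ND := normal_norm nD.
have nDQ : D <| Q := char_normal_trans (lower2_char 2 N) nN.
have QD := normal_norm nDQ.
have AN : A \subset N by rewrite NA subset_gen.
rewrite -quotient_cents2 // -/(abelian _).
apply: (@abelian_of_lower2 _ (Q / D)%G (N / D)%G (A / D) s).
- exact: quotient_pgroup.
- exact: quotient_normal.
- by rewrite -quotient_gen ?(subset_trans AN) // -NA.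
- by apply: leq_trans As; rewrite leq_exp2r // leq_quotient.
- by rewrite /= -quotient_Mho // quotientS.
- by rewrite -morphim_lower2 // trivg_quotient.
Qed.

(** * Normal subgroups of products of cyclic 2-groups *)

Lemma mem_cyclic_span (gT : finGroupType) (a : gT) (l : seq gT) :
  a \in l -> a \in cyclic_span l.
Proof.
case/splitPr => l1 l2; rewrite cyclic_span_cat -{1}[a]mul1g.
rewrite mem_mulg ?cyclic_span1 // /cyclic_span big_cons.
by have := mem_mulg (cycle_id a) (cyclic_span1 l2); rewrite mulg1.
Qed.

Section BoundedGeneration.
Variable gT : finGroupType.
Implicit Types (Q W N D C : {group gT}) (l : seq gT).

(** The counting principle by which a large quotient of small exponent
    contradicts generation by few cyclic factors. *)
Lemma index_cyclic_span m Q D l : (0 < m)%N -> Q \subset 'N(D) ->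
  {subset l <= Q} -> Q \subset cyclic_span l ->
  (forall x, x \in Q -> x ^+ m \in D) -> (#|Q / D| <= m ^ size l)%N.
Proof.
move=> m0 QD lQ Ql QmD.
have lD : {subset l <= 'N(D)} by move=> a /lQ /(subsetP QD).
apply: leq_trans (subset_leq_card (quotientS _ Ql)) _.
rewrite quotient_cyclic_span // -(size_map (coset D)).
apply: card_cyclic_span => // _ /mapP[a al ->].
by rewrite -morphX ?lD //; apply/coset_id/QmD/lQ.
Qed.

(** Burnside's basis theorem. *)
Lemma pgroup_gens N : 2.-group N ->
  exists2 A : {set gT}, N :=: <<A>> & #|A| = logn 2 #|N / 'Phi(N)|.
Proof.
move=> pN; have aN := Phi_quotient_abelem pN.
have NP := normal_norm (Phi_normal N).
have [B BN cB] := grank_witness (N / 'Phi(N))%G.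
have BNs : B \subset N / 'Phi(N) by rewrite -BN subset_gen.
have [f fP] : exists f : coset_of 'Phi(N) -> gT,
    {in B, forall b, f b \in N /\ coset _ (f b) = b}.
  have ex b : exists x, b \in B -> x \in N /\ coset 'Phi(N) x = b.
    have [bB|] := boolP (b \in B); last by exists 1.
    by have /morphimP[x _ xN ->] := subsetP BNs _ bB; exists x.
  by have [f fP] := boolp.choice ex; exists f => b bB; apply: fP.
have fN : f @: B \subset N by apply/subsetP => _ /imsetP[b /fP[fN _] ->].
exists (f @: B); last first.
  rewrite card_in_imset; last first.
    by move=> a b /fP[_ Ea] /fP[_ Eb] fab; rewrite -Ea fab Eb.
  by rewrite cB grank_abelian ?(abelem_abelian aN) // (rank_abelem aN).
apply/esym/Phi_nongen/eqP; rewrite eqEsubset join_subG Phi_sub fN /=.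
rewrite -joing_idr norm_joinEr ?gen_subG ?(subset_trans fN) //.
rewrite -quotientSK // ?gen_subG ?(subset_trans fN) //.
rewrite quotient_gen ?(subset_trans fN) // -[N / _]/(gval (N / 'Phi(N))%G) -BN genS //.
apply/subsetP => b bB; have [fbN <-] := fP _ bB.
by apply: mem_morphim; [exact: (subsetP NP) | exact: imset_f].
Qed.

(** W = 'Mho^s.+1(Q) centralizes N and is cyclic modulo N, hence is abelian.
    Counting elements of order 2 gives |N| <= |W : 'Mho^1(W)|, and the quotient
    of Q by 'Mho^1(W) has exponent at most 2^(s+2). *)
Lemma abelem_in_Mho s Q N z l : 2.-group Q -> N <| Q -> 2.-abelem N ->
  N \subset 'Mho^s.+1(Q) -> 'Mho^s.+1(Q) \subset N <*> <[z]> -> z \in Q ->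
  {subset l <= Q} -> Q \subset cyclic_span l ->
  (#|N| <= 2 ^ (2 ^ s))%N -> (#|N| <= 2 ^ (s.+2 * size l))%N.
Proof.
move=> pQ nN aN NW Wz zQ lQ Ql Ns; have [NQ QN] := andP nN.
set W := 'Mho^s.+1(Q)%G in NW Wz.
have nW : W <| Q := Mho_normal _ _; have [WQ QW] := andP nW.
have pW := pgroupS WQ pQ.
have WC : W \subset 'C(N).
  rewrite /W /= (MhoE _ pQ) gen_subG; apply/subsetP => _ /imsetP[q qQ ->].
  rewrite expnSr expgM groupX // (pow2_cent_abelem pQ) //.
  exact: subsetP QN _ qQ.
have cW : abelian W.
  apply: (@cyclic_factor_abelian _ N); first by rewrite subsetI NW centsC.
  have zN : z \in 'N(N) := subsetP QN _ zQ.
  apply: (cyclicS (quotientS N Wz)).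
  by rewrite /= quotientYidl ?cycle_subG // quotient_cycle // cycle_cyclic.
set D := 'Mho^1(W)%G.
have nD : D <| Q by exact: char_normal_trans (Mho_char _ _) nW.
have [DQ QD] := andP nD.
rewrite expnM; apply: leq_trans (index_cyclic_span _ QD lQ Ql _).
- apply: leq_trans (subset_leq_card (quotientS D WQ)).
  have DW : D \subset W := Mho_sub _ _.
  have WD : W \subset 'N(D) := subset_trans WQ QD.
  rewrite card_quotient // -divgS //.
  rewrite -(mul_card_Ohm_Mho_abelian 1 cW) mulnK ?cardG_gt0 //.
  apply: subset_leq_card.
  apply: subset_trans (OhmS 1 NW); rewrite (Ohm1_id aN) //.
- by rewrite expn_gt0.
move=> x xQ; rewrite expnSr expgM.
apply: (Mho_p_elt 1).
  by apply: Mho_p_elt => //; apply: mem_p_elt xQ.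
by apply: mem_p_elt (groupX _ xQ).
Qed.

End BoundedGeneration.

(** If N = C :&: 'Mho^s.+1(Q) needed more than r = (s+2) size l generators, a
    Q-invariant quotient of N would be elementary abelian of order exactly
    2^(r+1), which is small enough for [abelem_in_Mho] to apply but exceeds its
    bound 2^r. *)
Lemma Phi_index_bound (gT : finGroupType) s (Q C : {group gT}) l :
  2.-group Q -> C <| Q -> cyclic 'Mho^1(Q / C) ->
  {subset l <= Q} -> Q \subset cyclic_span l ->
  (s.+2 * size l < 2 ^ s)%N ->
  (logn 2 #|(C :&: 'Mho^s.+1(Q)) / 'Phi(C :&: 'Mho^s.+1(Q))| <= s.+2 * size l)%N.
Proof.
move=> pQ nC cQC lQ Ql rs; set r := (s.+2 * size l)%N in rs *.
set W := 'Mho^s.+1(Q)%G; set N := (C :&: W)%G.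
have nW : W <| Q := Mho_normal _ _; have [WQ QW] := andP nW.
have [CQ QC] := andP nC.
have nN : N <| Q by exact: normalI.
have [NQ QN] := andP nN; have pN := pgroupS NQ pQ.
have nF : 'Phi(N) <| Q := char_normal_trans (Phi_char N) nN.
rewrite -[C :&: _]/(gval N) leqNgt; apply/negP => rN.
set L := logn 2 _ in rN.
have pQF := quotient_pgroup 'Phi(N) pQ.
have [M [MN nM cM]] : exists M : {group coset_of 'Phi(N)},
    [/\ M \subset N / 'Phi(N), M <| Q / 'Phi(N) & #|M| = (2 ^ (L - r.+1))%N].
  by apply: normal_pgroup pQF (quotient_normal _ nN) _; rewrite leq_subr.
have [N' defM FN' nN'] := inv_quotientN nF nM.
have [N'Q QN'] := andP nN'.
have N'F : N' \subset 'N('Phi(N)) := subset_trans N'Q (normal_norm nF).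
have N'N : N' \subset N by rewrite -(quotientSGK N'F (Phi_sub N)) -defM.
have NN' : N \subset 'N(N') := subset_trans NQ QN'.
have nFN' : 'Phi(N)%G <| N' := normalS FN' N'Q nF.
have cNN' : #|N / N'| = (2 ^ r.+1)%N.
  rewrite card_quotient // -divgS // -(Lagrange (Phi_sub N)) -(Lagrange FN').
  rewrite divnMl ?cardG_gt0 // -!card_quotient ?normal_norm ?Phi_normal //.
  rewrite -defM cM (card_pgroup (quotient_pgroup _ pN)) -/L -expnB ?leq_subr //.
  by rewrite subKn.
have aNN' : 2.-abelem (N / N').
  move: FN'; rewrite /= (Phi_joing pN) join_subG => /andP[N1 N2].
  apply/(abelemP (isT : prime 2)); split; first exact: sub_der1_abelian.
  move=> _ /morphimP[x xN' xN ->]; rewrite -morphX //; apply: coset_id.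
  by apply: (subsetP N2); apply: (Mho_p_elt 1) => //; apply: mem_p_elt xN.
have [z zW Wz] : exists2 z, z \in W & W \subset N <*> <[z]>.
  have : cyclic (W / C).
    rewrite /= quotient_Mho //.
    exact: cyclicS (Mho_leq _ _) cQC.
  case/cyclicP => zb Ez; have : zb \in W / C by rewrite Ez cycle_id.
  case/morphimP => z zC zW defz; exists z => //.
  have WC : W \subset 'N(C) := subset_trans WQ QC.
  have : W \subset C * <[z]>.
    by rewrite -quotientSK // Ez defz quotient_cycle.
  move=> WCz.
  have zWs : <[z]> \subset W by rewrite cycle_subG.
  apply: subset_trans (mul_subG (joing_subl N <[z]>) (joing_subr N <[z]>)).
  by rewrite /= setIC group_modr // subsetI WCz subxx.
have lD : {subset l <= 'N(N')} by move=> a /lQ /(subsetP QN').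
have zQ := subsetP WQ _ zW.
have := @abelem_in_Mho _ s (Q / N')%G (N / N')%G (coset N' z) (map (coset N') l).
rewrite cNN' size_map !leq_exp2l // -/r ltnn => /(_ _ _ _ _ _ _ _ _ _)/notF; apply => //.
- exact: quotient_pgroup.
- exact: quotient_normal.
- by rewrite /= -quotient_Mho // quotientS // subsetIr.
- rewrite /= -quotient_Mho // -quotient_cycle ?(subsetP QN') //.
  rewrite -quotientY ?cycle_subG ?(subsetP QN') //.
  exact: quotientS.
- by rewrite mem_quotient.
- by move=> _ /mapP[a al ->]; rewrite mem_quotient // lQ.
- by rewrite -quotient_cyclic_span // quotientS.
Qed.

(** Two estimates that choose the parameters of the growth arguments. *)
Lemma linear_leq_exp2 a : exists k, (a * k.+1 <= 2 ^ k)%N.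
Proof.
exists (a.+1).*2; rewrite -addnn expnD; set m := a.+1.
have lt_exp n : (n < 2 ^ n)%N by apply: ltn_expl.
apply: (@leq_trans (2 * a * (2 ^ m))); last first.
  by rewrite leq_mul2r /m expnS leq_mul2l ltnW ?orbT.
rewrite -mulnA mulnCA leq_mul2l mul2n -addnn; apply/orP; right.
apply: (@leq_trans (m.+1 + m.+1)); last by rewrite leq_add.
by rewrite addSn addnS leqnSn.
Qed.

Lemma sqr_leq_exp2 d : exists s, ((s.+2 * d).+1 ^ 2 <= 2 ^ s)%N.
Proof.
have [k dk] := linear_leq_exp2 (2 * d.+1).
exists (k * 2)%N; rewrite expnM leq_exp2r //; apply: leq_trans dk.
have -> : (k * 2).+2 = (2 * k.+1)%N by rewrite mulnC [RHS]mulnS.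
rewrite -!mulnA [(d.+1 * _)%N]mulSn mulnDr [(k.+1 * d)%N]mulnC -addn1.
by rewrite [(2 * k.+1 + _)%N]addnC leq_add2l muln_gt0.
Qed.

(** C is the union of boundedly many cosets of the powerful group
    N = C :&: 'Mho^s.+1(Q), and each coset representative contributes one more
    cyclic factor. *)
Theorem normal_cyclic_span d : exists e, forall (gT : finGroupType)
    (Q C : {group gT}) (l : seq gT),
  2.-group Q -> C <| Q -> cyclic 'Mho^1(Q / C) ->
  {subset l <= Q} -> Q \subset cyclic_span l -> size l = d ->
  exists l' : seq gT,
    [/\ {subset l' <= C}, C \subset cyclic_span l' & (size l' <= e)%N].
Proof.
have [s ds] := sqr_leq_exp2 d; set r := (s.+2 * d)%N in ds.
exists ((2 ^ s.+1) ^ d + r)%N => gT Q C l pQ nC cQC lQ Ql sl.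
set W := 'Mho^s.+1(Q)%G; set N := (C :&: W)%G.
have nW : W <| Q := Mho_normal _ _; have [WQ QW] := andP nW.
have [CQ QC] := andP nC.
have nN : N <| Q by exact: normalI.
have [NQ QN] := andP nN; have pN := pgroupS NQ pQ.
have [A NA cA] := pgroup_gens pN.
have Ar : (#|A| <= r)%N.
  rewrite cA /r -sl; apply: Phi_index_bound => //; rewrite sl -/r.
  by apply: leq_trans ds; rewrite expnS expn1 leq_pmulr.
have NN : [~: N, N] \subset lower2 2 N.
  apply: (powerful_of_Mho pQ nN NA (s := s)); last exact: subsetIr.
  by apply: leq_trans ds; rewrite leq_exp2r // (leq_trans Ar).
have Nl : N \subset cyclic_span (enum A).
  apply: powerful_span => //; rewrite NA; congr <<_>>.
  by apply/setP => x; rewrite inE mem_enum.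
pose l1 := [seq repr X | X : {set gT} <- enum (lcosets N C)].
have reprS c : c \in C -> exists2 n, n \in N & repr (c *: N) = c * n.
  move=> cC; have : repr (c *: N) \in c *: N by apply: (mem_repr c); rewrite lcoset_refl.
  by case/lcosetP => n xN ->; exists n.
have NC : N \subset C := subsetIl _ _.
exists (l1 ++ enum A); split.
- move=> x; rewrite mem_cat => /orP[/mapP[X]|].
    rewrite mem_enum => /lcosetsP[c cC ->] ->; have [n xN ->] := reprS _ cC.
    by rewrite groupM // (subsetP NC).
  by rewrite mem_enum => xA; rewrite (subsetP NC) // NA mem_gen.
- rewrite cyclic_span_cat; apply/subsetP => c cC.
  have [n xN rE] := reprS _ cC.
  rewrite -[c](mulgK n) -rE mem_mulg //; last by rewrite (subsetP Nl) // groupV.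
  apply: mem_cyclic_span; apply/mapP; exists (c *: N) => //.
  by rewrite mem_enum; apply/lcosetsP; exists c.
rewrite size_cat -!cardE leq_add // size_map -cardE card_lcosets indexgI.
apply: leq_trans (_ : #|Q : W| <= _)%N.
  by apply: subset_leq_card; apply: imsetS.
rewrite -card_quotient // -sl; apply: index_cyclic_span => //.
  by rewrite expn_gt0.
by move=> x xQ; apply: Mho_p_elt => //; apply: mem_p_elt xQ.
Qed.

(** * Groups generated by two involutions *)

Section Dihedral.
Variable gT : finGroupType.
Implicit Types (x y z : gT).

Lemma cycle_norm_involution x y : x ^+ 2 = 1 -> y ^+ 2 = 1 ->
  x \in 'N(<[x * y]>).
Proof.
move=> x2 y2; have xV : x^-1 = x by apply/eqP; rewrite eq_invg_mul -expg2 x2.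
have yV : y^-1 = y by apply/eqP; rewrite eq_invg_mul -expg2 y2.
suff Jx : (x * y) ^ x = (x * y)^-1.
  by rewrite inE -cycleJ Jx cycleV.
by rewrite invgM conjgE xV yV !mulgA -expg2 x2 mul1g.
Qed.

Lemma involutions_gen x y : x ^+ 2 = 1 -> y ^+ 2 = 1 ->
  <<[set x; y]>> = <[x * y]> * <[x]>.
Proof.
move=> x2 y2; have xN := cycle_norm_involution x2 y2.
rewrite -norm_joinEr ?cycle_subG //; apply/eqP.
rewrite eqEsubset gen_subG subUset !sub1set join_subG !cycle_subG.
have xS : x \in <<[set x; y]>> by rewrite mem_gen // set21.
have yS : y \in <<[set x; y]>> by rewrite mem_gen // set22.
have xJ : x \in <[x * y]> <*> <[x]> by rewrite mem_gen // inE cycle_id orbT.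
have yJ : y \in <[x * y]> <*> <[x]>.
  rewrite -(groupMl _ xJ); exact: (subsetP (joing_subl _ _)) (cycle_id _).
by rewrite xJ yJ xS groupM.
Qed.

(** Elements outside <[x * y]> are involutions, as x inverts x * y. *)
Lemma sqr_involutions_gen x y z : x ^+ 2 = 1 -> y ^+ 2 = 1 ->
  z \in <<[set x; y]>> -> z ^+ 2 \in <[x * y]>.
Proof.
move=> x2 y2; rewrite involutions_gen // => /mulsgP[t e tC].
have xN := cycle_norm_involution x2 y2.
case/cycleP => n -> ->.
have eN : x ^+ n \in 'N(<[x * y]>) by rewrite groupX.
have -> : (t * x ^+ n) ^+ 2 = t * t ^ (x ^+ n)^-1 * x ^+ 2 ^+ n.
  by rewrite expg2 -expgM mulnC expgM expg2 conjgE invgK !mulgA mulgKV.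
by rewrite x2 expg1n mulg1 groupM // memJ_norm // groupV.
Qed.

End Dihedral.

Section DihedralQuotient.
Variable gT : finGroupType.
Implicit Types (C X Y Q : {group gT}) (l : seq gT).

Lemma index_le2_normal C X : C \subset X -> (#|X : C| <= 2)%N -> C <| X.
Proof.
move=> CX; rewrite leq_eqVlt => /orP[/eqP/index2_normal->//|].
by rewrite ltnS leqNgt indexg_gt1 negbK => XC; rewrite /normal CX (subset_trans XC) ?normG.
Qed.

Lemma quotient_le2 C X : C \subset X -> (#|X : C| <= 2)%N ->
  exists2 x : coset_of C, x ^+ 2 = 1 & X / C = <[x]>.
Proof.
move=> CX XC; have [_ XN] := andP (index_le2_normal CX XC).
have c2 : (#|X / C| <= 2)%N by rewrite card_quotient.
have [x Ex] : exists x : coset_of C, X / C = <[x]>.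
  apply/cyclicP; move: c2; rewrite leq_eqVlt => /orP[/eqP c2|].
    by apply: prime_cyclic; rewrite c2.
  by rewrite ltnS -trivg_card_le1 => /eqP->; exact: cyclic1.
exists x => //; apply/eqP; rewrite -order_dvdn /order -Ex.
by move: c2 (cardG_gt0 (X / C)); case: #|_| => [|[|[|]]].
Qed.

(** The bound 2 on the indices allows index 1, in which case the involution is
    trivial. *)
Lemma dihedral_quotient C X Y : C \subset X -> C \subset Y ->
  (#|X : C| <= 2)%N -> (#|Y : C| <= 2)%N ->
  C <| X <*> Y /\ exists x y : coset_of C,
    [/\ x ^+ 2 = 1, y ^+ 2 = 1 & (X <*> Y) / C = <<[set x; y]>>].
Proof.
move=> CX CY XC YC.
have [_ XN] := andP (index_le2_normal CX XC).
have [_ YN] := andP (index_le2_normal CY YC).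
have [x x2 Ex] := quotient_le2 CX XC; have [y y2 Ey] := quotient_le2 CY YC.
split; first by rewrite /normal (subset_trans CX (joing_subl _ _)) join_subG XN.
exists x, y; split => //.
by rewrite quotientY // Ex Ey joing_idl joing_idr.
Qed.

Lemma dihedral_Mho1_cyclic C X Y : 2.-group (X <*> Y) ->
  C \subset X -> C \subset Y ->
  (#|X : C| <= 2)%N -> (#|Y : C| <= 2)%N ->
  cyclic 'Mho^1((X <*> Y) / C).
Proof.
move=> pQ CX CY XC YC.
have [nC [x [y [x2 y2 E]]]] := dihedral_quotient CX CY XC YC.
apply: (@cyclicS _ <[x * y]>); last exact: cycle_cyclic.
have := MhoE 1 (quotient_pgroup C pQ); rewrite /= => ->; rewrite gen_subG.
by apply/subsetP => _ /imsetP[z zQ ->]; apply: sqr_involutions_gen => //; rewrite -E.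
Qed.

Lemma dihedral_cyclic_span C X Y l : C \subset X -> C \subset Y ->
  (#|X : C| <= 2)%N -> (#|Y : C| <= 2)%N ->
  {subset l <= C} -> C \subset cyclic_span l ->
  exists l', [/\ {subset l' <= X <*> Y}, X <*> Y \subset cyclic_span l' &
    size l' = (size l).+2].
Proof.
move=> CX CY XC YC lC Cl.
have [/andP[CQ QC] [x [y [x2 y2 E]]]] := dihedral_quotient CX CY XC YC.
have : x * y \in (X <*> Y) / C by rewrite E groupM // mem_gen // !inE eqxx ?orbT.
have : x \in (X <*> Y) / C by rewrite E mem_gen // set21.
case/morphimP => a aN aQ Ea /morphimP[t tN tQ Et].
exists (l ++ [:: t; a]); split; last by rewrite size_cat addn2.
  move=> z; rewrite mem_cat !inE => /orP[/lC/(subsetP CQ)//|].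
  by case/orP => /eqP->.
rewrite cyclic_span_cat; apply: subset_trans (mulSg _ Cl).
rewrite -quotientSK // E involutions_gen // Et {1}Ea.
rewrite /cyclic_span !big_cons big_nil mulg1 quotientMl ?cycle_subG //.
by rewrite !quotient_cycle.
Qed.

End DihedralQuotient.

(** * Finite quotients of an amalgamated product *)

Lemma homX (G T : groupType) (f : {multiplicative G -> T}) x n :
  f (x ^+ n) = f x ^+ n.
Proof.
by elim: n => [|n IHn]; [exact: hom1 | rewrite !expgS gmulfM IHn].
Qed.

Lemma hom_to_multiplicative (G T : groupType) (f : G -> T) : group_hom f ->
  exists g : {multiplicative G -> T}, g = f :> (G -> T).
Proof.
move=> hf.
pose F : {multiplicative G -> T} := HB.pack f (isMultiplicative.Build G T f hf).
by exists F.
Qed.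

Section HomImage.
Variables (G : groupType) (T : finGroupType).
Implicit Types f : {multiplicative G -> T}.

Definition hom_image f : {set T} := [set t | boolp.asbool (exists g, f g = t)].

Lemma hom_imageP f t : reflect (exists g, f g = t) (t \in hom_image f).
Proof. by rewrite inE; exact: boolp.asboolP. Qed.

Lemma mem_hom_image f g : f g \in hom_image f.
Proof. by apply/hom_imageP; exists g. Qed.

Fact hom_image_group_set f : group_set (hom_image f).
Proof.
apply/group_setP; split; first by apply/hom_imageP; exists 1; exact: hom1.
by move=> _ _ /hom_imageP[g <-] /hom_imageP[h <-]; rewrite -gmulfM mem_hom_image.
Qed.

Canonical hom_image_group f := Group (hom_image_group_set f).

End HomImage.

Lemma hom_image_comp_sub (H G : groupType) (T : finGroupType)
    (u : {multiplicative G -> T}) (f : {multiplicative H -> G}) :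
  hom_image (u \o f) \subset hom_image u.
Proof. by apply/subsetP => _ /hom_imageP[h <-]; exact: mem_hom_image. Qed.

Section Amalgam.
Variables (K H1 H2 Gamma : groupType).
Variables (i1 : {multiplicative K -> H1}) (i2 : {multiplicative K -> H2}).
Variables (j1 : {multiplicative H1 -> Gamma}) (j2 : {multiplicative H2 -> Gamma}).
Hypothesis amalgam : amalgamated_free_product i1 i2 j1 j2.

Lemma amalgam_comm k : j1 (i1 k) = j2 (i2 k).
Proof. by case: amalgam => _ _ _ E _; exact: (congr1 (fun f => f k) E). Qed.

Lemma amalgam_unique (T : groupType) (u v : {multiplicative Gamma -> T}) :
  (forall h, u (j1 h) = v (j1 h)) -> (forall h, u (j2 h) = v (j2 h)) -> u =1 v.
Proof.
case: amalgam => _ _ _ E /(_ T (u \o j1) (u \o j2)) univ uv1 uv2 g.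
have [|||w [_ wP]] := univ.
- by move=> x y; rewrite /= !gmulfM.
- by move=> x y; rewrite /= !gmulfM.
- by apply/boolp.funext => k /=; have := congr1 (fun f => f k) E; rewrite /= => ->.
have <- : w = u by apply: wP; split=> //; exact: gmulfM.
have <- // : w = v; apply: wP; split; first exact: gmulfM.
  by apply/boolp.funext => h /=.
by apply/boolp.funext => h /=.
Qed.

Lemma amalgam_lift (T : finGroupType) (t1 : {multiplicative H1 -> T})
    (t2 : {multiplicative H2 -> T}) : (forall k, t1 (i1 k) = t2 (i2 k)) ->
  exists u : {multiplicative Gamma -> T},
    (forall h, u (j1 h) = t1 h) /\ (forall h, u (j2 h) = t2 h).
Proof.
move=> t12; case: amalgam => _ _ _ _ univ.
have [|||u [[hu u1 u2] _]] := univ T t1 t2.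
- exact: gmulfM.
- exact: gmulfM.
- by apply/boolp.funext.
have [v vE] := hom_to_multiplicative hu.
by exists v; rewrite vE; split=> h; rewrite -?u1 -?u2.
Qed.

End Amalgam.

Import GRing.Theory.

(** * Enlarging a finite quotient of an amalgamated product *)

Section AffineGroup.
Variables (p : nat) (T : finGroupType).
Local Notation M := {ffun {set T} -> 'F_p}.

Definition translate (q : T) (f : M) : M := [ffun X => f (q^-1 *: X)].

Lemma translate1 f : translate 1 f = f.
Proof. by apply/ffunP => X; rewrite ffunE invg1 lcoset1. Qed.

Lemma translateM q r f : translate (q * r) f = translate q (translate r f).
Proof. by apply/ffunP => X; rewrite !ffunE invMg lcosetM. Qed.

Lemma translateD q f g : translate q (f + g)%R = (translate q f + translate q g)%R.
Proof. by apply/ffunP => X; rewrite !ffunE. Qed.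

Lemma translateN q f : translate q (- f)%R = (- translate q f)%R.
Proof. by apply/ffunP => X; rewrite !ffunE. Qed.

Lemma translate0 q : translate q 0%R = 0%R.
Proof. by apply/ffunP => X; rewrite !ffunE. Qed.

Definition delta (S : {set T}) : M := [ffun X => (X == S)%:R%R].

Lemma translate_delta q (S : {set T}) : translate q (delta S) = delta (q *: S).
Proof.
apply/ffunP => X; rewrite !ffunE; congr (_%:R)%R; congr nat_of_bool.
apply/eqP/eqP => [<-|->]; first by rewrite -lcosetM mulgV lcoset1.
by rewrite -lcosetM mulVg lcoset1.
Qed.

(** The semidirect product of the F_p-valued functions on the subsets of T with
    T; all subsets are allowed so that the coset spaces of the various subgroups
    of T live in one module. *)
Definition affine : Type := M * T.
HB.instance Definition _ := Finite.on affine.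

Definition affine_mul (a b : affine) : affine :=
  ((a.1 + translate a.2 b.1)%R, a.2 * b.2).
Definition affine_inv (a : affine) : affine :=
  ((- translate a.2^-1 a.1)%R, a.2^-1).

Fact affine_mulA : associative affine_mul.
Proof.
move=> [f q] [g r] [h s]; congr pair => /=; last exact: mulgA.
by rewrite translateD translateM addrA.
Qed.

Fact affine_mul1 : left_id (0%R, 1) affine_mul.
Proof. by move=> [f q]; rewrite /affine_mul /= translate1 add0r mul1g. Qed.

Fact affine_mulV : left_inverse (0%R, 1) affine_inv affine_mul.
Proof. by move=> [f q]; rewrite /affine_mul /= addNr mulVg. Qed.

HB.instance Definition _ :=
  Finite_isGroup.Build affine affine_mulA affine_mul1 affine_mulV.

Lemma affineME (a b : affine) : a * b = ((a.1 + translate a.2 b.1)%R, a.2 * b.2).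
Proof. by []. Qed.

Lemma affine_expE (f : M) n : ((f, 1) : affine) ^+ n = ((f *+ n)%R, 1).
Proof.
elim: n => [|n IHn]; first by rewrite expg0 mulr0n.
by rewrite expgS IHn affineME /= translate1 mulg1 mulrS.
Qed.

Lemma mulrn_natr0 (f : M) n : (n%:R = 0 :> 'F_p)%R -> (f *+ n = 0)%R.
Proof.
move=> n0; apply/ffunP => X; rewrite !ffunE.
rewrite ffunMnE -mulr_natr n0 mulr0 //.
Qed.

Lemma affine_exp (a : affine) n : prime p -> a.2 ^+ n = 1 -> a ^+ (n * p) = 1.
Proof.
move=> p_pr an; have : (a ^+ n).2 = 1.
  by rewrite -an; elim: n {an} => [//|n IHn]; rewrite !expgS affineME /= IHn.
rewrite expgM; case: (a ^+ n) => f _ /= ->.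
by rewrite affine_expE mulrn_natr0 // pchar_Fp_0.
Qed.

End AffineGroup.
Section Growth.
Variables (p : nat) (K H1 H2 Gamma : groupType).
Variables (i1 : {multiplicative K -> H1}) (i2 : {multiplicative K -> H2}).
Variables (j1 : {multiplicative H1 -> Gamma}) (j2 : {multiplicative H2 -> Gamma}).
Hypothesis amalgam : amalgamated_free_product i1 i2 j1 j2.
Hypothesis p_prime : prime p.
Variables (T : finGroupType) (u : {multiplicative Gamma -> T}).

Local Notation M := {ffun {set T} -> 'F_p}.
Local Notation A := (affine p T).
Local Notation Q := (hom_image u).
Local Notation X1 := (hom_image (u \o j1)).
Local Notation X2 := (hom_image (u \o j2)).
Local Notation C := (hom_image (u \o j1 \o i1)).
Local Notation E := (lcosets C Q).

(** For X the image of H1 or H2: the component in the vertices Q / X of the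
    boundary of f, viewed as a 1-chain on the graph whose edges are the cosets
    of C. *)
Definition boundary (X : {set T}) (f : M) : M :=
  [ffun V => if V \in lcosets X Q then (\sum_(S in E | (S * X)%g == V) f S)%R else 0%R].

Lemma boundaryB X f g : boundary X (f - g)%R = (boundary X f - boundary X g)%R.
Proof.
apply/ffunP => V; rewrite !ffunE; case: ifP => _; last by rewrite subr0.
by rewrite -sumrB; apply: eq_bigr => S _; rewrite !ffunE.
Qed.

Section Derivation.
Variable v : {multiplicative Gamma -> A}.
Hypothesis vu : forall g, (v g).2 = u g.
Local Notation D g := (v g%g).1.
(* D is a derivation from Gamma to M; R is its image on the kernel of u *)
Let R (f : M) := exists g, v g = (f, 1).

Lemma derivationM g h : D (g * h) = (D g + translate (u g) (D h))%R.
Proof. by rewrite gmulfM affineME vu. Qed.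

Lemma relationD f g : R f -> R g -> R (f + g)%R.
Proof.
move=> [x xE] [y yE]; exists (x * y).
by rewrite gmulfM xE yE affineME /= translate1 mulg1.
Qed.

Lemma relationN f : R f -> R (- f)%R.
Proof.
move=> [x xE]; exists x^-1; rewrite homV xE; apply: (@mulgI A (f, 1)).
by rewrite mulgV affineME /= translate1 mulg1 subrr.
Qed.

Lemma relationMn f n : R f -> R (f *+ n)%R.
Proof. by move=> [x xE]; exists (x ^+ n); rewrite homX xE affine_expE. Qed.

Lemma relation_sum (I : finType) (P : pred I) (F : I -> M) :
  (forall i, P i -> R (F i)) -> R (\sum_(i | P i) F i)%R.
Proof.
move=> PF; elim/big_rec: _ => [|i f Pi]; last exact: relationD (PF i Pi).
by exists 1; rewrite hom1.
Qed.

Lemma derivation_ker g h : u h = 1 -> R (D (g * h) - D g)%R.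
Proof.
move=> uh; exists (g * h * g^-1).
rewrite [LHS]surjective_pairing; congr pair.
  rewrite derivationM [u (g * h)]gmulfM uh mulg1; congr (_ + _)%R.
  apply/eqP; rewrite -addr_eq0 addrC -derivationM.
  by rewrite mulgV hom1.
by rewrite vu !gmulfM homV uh mulg1 mulgV.
Qed.

(** Modulo the submodule R, the function b depends only on the coset of X that
    contains u g.  So the sum of the values b (rep S), weighted by f S, can be
    collected along the cosets of X, where the weights add up to the boundary
    of f. *)
Lemma relation_coset_sum (H : groupType) (j : {multiplicative H -> Gamma})
    (b : Gamma -> M) (f : M) (rep : {set T} -> Gamma) :
  (forall S, S \in E -> u (rep S) \in S) -> C \subset hom_image (u \o j) ->
  (forall g h, b (g * j h) = b g) ->
  (forall g h, u h = 1 -> R (b (g * h)%g - b g)%R) ->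
  boundary (hom_image (u \o j)) f = 0%R ->
  R (\sum_(S in E) b (rep S) *+ f S)%R.
Proof.
set X := hom_image (u \o j) => repP CX bj bk df.
have repE S : S \in E -> S = u (rep S) *: C.
  by move=> SE; have := repP _ SE; case/lcosetsP: SE => q _ -> /lcoset_eqP.
have SX S : S \in E -> S * X = u (rep S) *: X.
  by move=> /repE {1}->; rewrite -mulgA mulSGid.
have [rX rXP] : exists rX : {set T} -> Gamma,
    forall V, V \in lcosets X Q -> V = u (rX V) *: X.
  have ex V : exists g, V \in lcosets X Q -> V = u g *: X.
    have [/lcosetsP[_ /hom_imageP[g <-] ->]|] := boolP (V \in lcosets X Q).
      by exists g.
    by exists 1.
  by have [r rP] := boolp.choice ex; exists r.
have SXQ S : S \in E -> S * X \in lcosets X Q.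
  by move=> /SX ->; apply/lcosetsP; exists (u (rep S)); rewrite ?mem_hom_image.
have -> : (\sum_(S in E) b (rep S) *+ f S =
    \sum_(S in E) (b (rep S) - b (rX (S * X)%g)) *+ f S +
    \sum_(S in E) b (rX (S * X)%g) *+ f S)%R.
  by rewrite -big_split /=; apply: eq_bigr => S _; rewrite -mulrnDl subrK.
apply: relationD.
  apply: relation_sum => S SE; apply: relationMn.
  have : u (rep S) *: X = u (rX (S * X)) *: X by rewrite -rXP ?SXQ // SX.
  move/lcoset_eqP; rewrite mem_lcoset => /hom_imageP[h /= hE].
  rewrite -(bj (rX (S * X)) h) -[rep S](mulKVg (rX (S * X) * j h)); apply: bk.
  rewrite gmulfM homV gmulfM hE.
  by rewrite mulKVg mulVg.
rewrite (partition_big (fun S : {set T} => S * X) (mem (lcosets X Q))) //=.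
rewrite big1; first by exists 1; rewrite hom1.
move=> V VX; rewrite (eq_bigr (fun S : {set T} => b (rX V) *+ f S)%R); last first.
  by move=> S /andP[_ /eqP->].
rewrite sumrMnr; apply: mulrn_natr0.
have := congr1 (fun g : M => g V) df; rewrite !ffunE VX => <-.
rewrite natr_sum; apply: eq_bigr => S _.
by rewrite natr_Zp.
Qed.

End Derivation.

(* the basis vector that is fixed by C *)
Let m : M := delta p C.

(** The inclusion of X1 conjugated by m. *)
Fact twist_morph : group_hom (fun h : H1 =>
  ((m - translate (u (j1 h)) m)%R, u (j1 h)) : A).
Proof.
move=> h h' /=; rewrite affineME /= !gmulfM; congr pair.
by rewrite translateM translateD translateN addrA addrNK.
Qed.

Fact plain_morph : group_hom (fun h : H2 => (0%R, u (j2 h)) : A).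
Proof. by move=> h h' /=; rewrite affineME /= !gmulfM translate0 addr0. Qed.

Lemma twisted_lift : exists v : {multiplicative Gamma -> A},
  [/\ forall g, (v g).2 = u g,
      forall h, v (j1 h) = ((m - translate (u (j1 h)) m)%R, u (j1 h)) &
      forall h, v (j2 h) = (0%R, u (j2 h))].
Proof.
have [t1 t1E] := hom_to_multiplicative twist_morph.
have [t2 t2E] := hom_to_multiplicative plain_morph.
have [k|v [v1 v2]] := amalgam_lift amalgam (t1 := t1) (t2 := t2).
  rewrite t1E t2E -(amalgam_comm amalgam); congr pair; apply/eqP.
  rewrite translate_delta subr_eq0; apply/eqP; congr delta.
  by rewrite lcoset_id //; exact: (mem_hom_image (u \o j1 \o i1)).
exists v; split=> [g|h|h]; [|by rewrite v1 t1E|by rewrite v2 t2E].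
have v_snd : group_hom (fun g => (v g).2) by move=> x y; rewrite /= gmulfM.
have [w wE] := hom_to_multiplicative v_snd.
rewrite -[LHS]/((fun g => (v g).2) g) -wE.
apply: (amalgam_unique amalgam) => h; rewrite wE; first by rewrite v1 t1E.
by rewrite v2 t2E.
Qed.

Lemma hom_imageC_sub2 : C \subset X2.
Proof.
apply/subsetP => _ /hom_imageP[k <-] /=; rewrite (amalgam_comm amalgam).
exact: (mem_hom_image (u \o j2)).
Qed.

(** The function b1 g = D g + u g m is constant on the cosets of H1 and D on
    those of H2, while their difference at g is the basis vector of the coset
    u g C.  Writing f in this basis and applying [relation_coset_sum] to both
    parts shows that the cycle f lies in the image of the kernel of u. *)
Lemma relation_of_cycle (v : {multiplicative Gamma -> A}) (f : M) :
  (forall g, (v g).2 = u g) ->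
  (forall h, v (j1 h) = ((m - translate (u (j1 h)) m)%R, u (j1 h))) ->
  (forall h, v (j2 h) = (0%R, u (j2 h))) ->
  (forall S, S \notin E -> f S = 0%R) ->
  boundary X1 f = 0%R -> boundary X2 f = 0%R -> exists g, v g = (f, 1).
Proof.
move=> vu v1 v2 fE f1 f2.
have [rep repP] : exists r : {set T} -> Gamma, forall S, S \in E -> S = u (r S) *: C.
  have ex S : exists g, S \in E -> S = u g *: C.
    have [/lcosetsP[_ /hom_imageP[g <-] ->]|] := boolP (S \in E); first by exists g.
    by exists 1.
  by have [r rP] := boolp.choice ex; exists r.
have repS S : S \in E -> u (rep S) \in S.
  by move=> SE; rewrite {2}(repP _ SE) lcoset_refl.
pose b1 g := ((v g).1 + translate (u g) m)%R.
have b1j g h : b1 (g * j1 h) = b1 g.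
  rewrite /b1 (derivationM vu) v1 /= translateD translateN gmulfM translateM.
  by rewrite addrA addrNK.
have b2j g h : (v (g * j2 h)).1 = (v g).1.
  by rewrite (derivationM vu) v2 /= translate0 addr0.
have b1k g h : u h = 1 -> exists k, v k = ((b1 (g * h)%g - b1 g)%R, 1).
  move=> uh; rewrite /b1 [u (g * h)]gmulfM uh mulg1 opprD addrACA subrr addr0.
  exact: derivation_ker.
have r1 := relation_coset_sum repS (hom_image_comp_sub (u \o j1) i1) b1j b1k f1.
have r2 := relation_coset_sum repS hom_imageC_sub2 b2j (derivation_ker vu) f2.
have := relationD r1 (relationN r2).
suff -> : (\sum_(S in E) b1 (rep S) *+ f S - \sum_(S in E) (v (rep S)).1 *+ f S = f)%R by [].
rewrite -sumrB; apply/ffunP => S; rewrite sum_ffunE.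
have term (S' : {set T}) : S' \in E ->
    ((b1 (rep S') *+ f S' - (v (rep S')).1 *+ f S') S = (S == S')%:R * f S')%R.
  move=> SE; rewrite -mulrnBl /b1 addrAC subrr add0r translate_delta -repP //.
  by rewrite ffunMnE ffunE -[LHS]mulr_natr natr_Zp.
rewrite (eq_bigr (fun S' => (S == S')%:R * f S')%R) //.
have [SE|SE] := boolP (S \in E); last first.
  rewrite fE // big1 // => S' SE'; case: eqP => [e|]; last by rewrite mul0r.
  by rewrite e SE' in SE.
rewrite (bigD1 S) //= eqxx mul1r big1 ?addr0 // => S' /andP[_ ne].
by rewrite eq_sym (negPf ne) mul0r.
Qed.

(** A function f on the cosets of C is determined by its boundary and by a
    cycle, and cycles are values of D on the kernel of u.  So f and an element q
    of Q are recovered from an element of the new image and the boundary of f: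
    this gives the last inequality. *)
Lemma growth_step e : (forall g, u g ^+ (p ^ e) = 1) ->
  exists (T' : finGroupType) (v : {multiplicative Gamma -> T'}),
  [/\ forall g, v g ^+ (p ^ e.+1) = 1,
      #|hom_image (v \o j1)| = #|X1|,
      #|hom_image (v \o j2)| = #|X2|,
      #|hom_image (v \o j1 \o i1)| = #|C| &
      (#|Q| * p ^ #|Q : C| <= #|hom_image v| * p ^ (#|Q : X1| + #|Q : X2|))%N].
Proof.
move=> ue; have [v [vu v1 v2]] := twisted_lift.
exists A, v; split.
- by move=> g; rewrite expnSr affine_exp // vu.
- rewrite -(card_imset (mem X1) (f := fun x : T => ((m - translate x m)%R, x) : A)).
    apply: eq_card => a; apply/hom_imageP/imsetP => [[h <-]|[_ /hom_imageP[h <-] ->]].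
      by exists (u (j1 h)); [exact: (mem_hom_image (u \o j1)) | rewrite /= v1].
    by exists h; rewrite /= v1.
  by move=> x y [].
- rewrite -(card_imset (mem X2) (f := fun x : T => (0%R, x) : A)).
    apply: eq_card => a; apply/hom_imageP/imsetP => [[h <-]|[_ /hom_imageP[h <-] ->]].
      by exists (u (j2 h)); [exact: (mem_hom_image (u \o j2)) | rewrite /= v2].
    by exists h; rewrite /= v2.
  by move=> x y [].
- rewrite -(card_imset (mem C) (f := fun x : T => (0%R, x) : A)).
    apply: eq_card => a; apply/hom_imageP/imsetP => [[h <-]|[_ /hom_imageP[h <-] ->]].
      exists (u (j1 (i1 h))); first exact: (mem_hom_image (u \o j1 \o i1)).
      by rewrite /= (amalgam_comm amalgam) v2.
    by exists h; rewrite /= (amalgam_comm amalgam) v2.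
  by move=> x y [].
pose supp (P : {set {set T}}) : {set M} := [set f : M | f \in pffun_on 0%R P predT].
have card_supp (P : {set {set T}}) : #|supp P| = (p ^ #|P|)%N.
  rewrite cardsE card_pffun_on; congr expn; rewrite -[RHS](card_Fp p_prime).
  by apply: eq_card.
have suppP (P : {set {set T}}) (f : M) :
    reflect (forall S, S \notin P -> f S = 0%R) (f \in supp P).
  rewrite in_set; apply: (iffP pffun_onP) => [[/subsetP sf _] S SP|fP].
    by apply/eqP; apply: contraNT SP => fS; apply: sf.
  split=> // ; apply/subsetP => S; apply: contraTT => /fP fS.
  by rewrite inE fS eqxx.
(* rho picks one chain with a given boundary *)
have [rho rhoP] : exists rho : M * M -> M, forall f, f \in supp E ->
    [/\ rho (boundary X1 f, boundary X2 f) \in supp E,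
        boundary X1 (rho (boundary X1 f, boundary X2 f)) = boundary X1 f &
        boundary X2 (rho (boundary X1 f, boundary X2 f)) = boundary X2 f].
  have ex (y : M * M) : exists r, forall f, f \in supp E ->
      (boundary X1 f, boundary X2 f) = y ->
      [/\ r \in supp E, boundary X1 r = y.1 & boundary X2 r = y.2].
    have [[f fE <-]|no] := boolp.pselect
        (exists2 f, f \in supp E & (boundary X1 f, boundary X2 f) = y).
      by exists f => ? _ _.
    by exists 0%R => f fE fy; case: no; exists f.
  by have [r rP] := boolp.choice ex; exists r => f fE; apply: (rP _ f).
have [sec secP] : exists sec : T -> A, forall q, q \in Q ->
    sec q \in hom_image v /\ (sec q).2 = q.
  have ex q : exists a : A, q \in Q -> a \in hom_image v /\ a.2 = q.
    have [/hom_imageP[g gE]|] := boolP (q \in Q); last by exists 1.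
    by exists (v g) => _; rewrite mem_hom_image vu.
  by have [r rP] := boolp.choice ex; exists r.
pose Phi (x : M * T) : A * (M * M) :=
  ((((x.1 - rho (boundary X1 x.1, boundary X2 x.1))%R, 1) : A) * sec x.2,
   (boundary X1 x.1, boundary X2 x.1)).
rewrite expnD -!card_lcosets -!card_supp [leqLHS]mulnC -!cardsX.
rewrite -(card_in_imset (f := Phi)); last first.
  move=> [f q] [f' q'] /setXP[/= fE qQ] /setXP[/= fE' qQ'] PhiE.
  have E1 := congr1 (fun z => z.1.1) PhiE; have E2 := congr1 (fun z => z.1.2) PhiE.
  have E3 := congr1 (fun z => z.2.1) PhiE; have E4 := congr1 (fun z => z.2.2) PhiE.
  rewrite /Phi /= in E3 E4; rewrite /Phi !affineME /= in E1 E2.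
  rewrite !mul1g in E2; rewrite !translate1 in E1.
  have [_ sq] := secP _ qQ; have [_ sq'] := secP _ qQ'.
  have qq' : q = q' by rewrite -sq -sq' E2.
  congr pair => //; move: E1; rewrite qq' E3 E4 => /addIr.
  exact: addIr.
apply: subset_leq_card; apply/subsetP => _ /imsetP[[f q] /setXP[/= fE qQ] ->].
have [sQ _] := secP _ qQ; have [rE r1 r2] := rhoP _ fE.
have bsupp (X : {set T}) (f' : M) : boundary X f' \in supp (lcosets X Q).
  by apply/suppP => V VX; rewrite ffunE (negPf VX).
apply/setXP; split; last by apply/setXP; split; exact: bsupp.
apply: groupM sQ; have [|||g <-] := relation_of_cycle (f := (f -
    rho (boundary X1 f, boundary X2 f))%R) vu v1 v2; last exact: mem_hom_image.
- by move=> S SE; rewrite !ffunE (suppP _ _ fE) // (suppP _ _ rE) // subrr.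
- by rewrite boundaryB r1 subrr.
- by rewrite boundaryB r2 subrr.
Qed.

End Growth.

(** * Bounded generation forces index two *)

(** With n = q / c, a = q / x1 and b = q / x2 this says that
    q / c - q / x1 - q / x2 is at least q / (x1 x2 c). *)
Lemma index_gap q x1 x2 c a b n : (a * x1 = q -> b * x2 = q -> n * c = q ->
  c * (x1 + x2) < x1 * x2 -> (a + b) * (x1 * x2 * c) + q <= n * (x1 * x2 * c))%N.
Proof.
move=> aq bq nq lt.
have -> : ((a + b) * (x1 * x2 * c) = q * (c * (x1 + x2)))%N.
  rewrite mulnDl.
  have -> : (a * (x1 * x2 * c) = a * x1 * (c * x2))%N.
    by rewrite -!mulnA [(x2 * c)%N]mulnC.
  have -> : (b * (x1 * x2 * c) = b * x2 * (c * x1))%N.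
    by rewrite (mulnC x1 x2) -!mulnA [(x1 * c)%N]mulnC.
  by rewrite aq bq -mulnDr -mulnDr addnC.
have -> : (n * (x1 * x2 * c) = q * (x1 * x2))%N by rewrite mulnA mulnAC nq.
by rewrite -[X in (_ + X <= _)%N]muln1 -mulnDr leq_mul2l addn1 lt orbT.
Qed.

Section BoundedOrders.
Variables (p : nat) (K H1 H2 Gamma : groupType).
Variables (i1 : {multiplicative K -> H1}) (i2 : {multiplicative K -> H2}).
Variables (j1 : {multiplicative H1 -> Gamma}) (j2 : {multiplicative H2 -> Gamma}).
Hypothesis amalgam : amalgamated_free_product i1 i2 j1 j2.
Hypothesis p_prime : prime p.
Variable d : nat.
Hypothesis bounded : forall (T : finGroupType) (v : {multiplicative Gamma -> T}) e,
  (forall g, v g ^+ (p ^ e) = 1) -> (#|hom_image v| <= (p ^ e) ^ d)%N.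

(** If the inequality fails, [growth_step] multiplies the order by p^n where n
    is at least |Q| / (x1 x2 c), while x1, x2 and c do not change.  After k
    steps |Q| is at least p^k, so the next step makes the order at least
    p^(p^k / (x1 x2 c)), although the exponent is only p^(e + k + 1). *)
Theorem amalgam_index_bound (T : finGroupType) (u : {multiplicative Gamma -> T}) e :
  (forall g, u g ^+ (p ^ e) = 1) ->
  (#|hom_image (u \o j1)| * #|hom_image (u \o j2)| <=
   #|hom_image (u \o j1 \o i1)| *
     (#|hom_image (u \o j1)| + #|hom_image (u \o j2)|))%N.
Proof.
move=> ue; rewrite leqNgt; apply/negP.
set c := #|_|; set x1 := #|_|; set x2 := #|_| => lt.
pose inv (T' : finGroupType) (v : {multiplicative Gamma -> T'}) k :=
  [/\ forall g, v g ^+ (p ^ (e + k)) = 1, #|hom_image (v \o j1)| = x1,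
      #|hom_image (v \o j2)| = x2, #|hom_image (v \o j1 \o i1)| = c &
      (p ^ k <= #|hom_image v|)%N].
have step (T' : finGroupType) (v : {multiplicative Gamma -> T'}) k : inv T' v k ->
  exists (T2 : finGroupType) (w : {multiplicative Gamma -> T2}) n,
    [/\ forall g, w g ^+ (p ^ (e + k.+1)) = 1, #|hom_image (w \o j1)| = x1,
      #|hom_image (w \o j2)| = x2, #|hom_image (w \o j1 \o i1)| = c &
      (#|hom_image v| <= n * (x1 * x2 * c))%N /\
      (#|hom_image v| * p ^ n <= #|hom_image w|)%N].
  case=> ve v1 v2 vc vk.
  have [T2 [w [we w1 w2 wc wQ]]] := growth_step amalgam p_prime ve.
  set a := #|_ : hom_image (v \o j1)| in wQ; set b := #|_ : hom_image (v \o j2)| in wQ.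
  set n := #|_ : _| in wQ.
  have sub1 := hom_image_comp_sub v j1; have sub2 := hom_image_comp_sub v j2.
  have subC := subset_trans (hom_image_comp_sub (v \o j1) i1) sub1.
  have gap : ((a + b) * (x1 * x2 * c) + #|hom_image v| <= n * (x1 * x2 * c))%N.
    apply: (index_gap _ _ _ lt); rewrite mulnC.
    - by rewrite -v1; exact: Lagrange.
    - by rewrite -v2; exact: Lagrange.
    - by rewrite -vc; exact: Lagrange.
  have abn : (a + b <= n)%N.
    have c0 : (0 < x1 * x2 * c)%N by rewrite !muln_gt0 !cardG_gt0.
    by rewrite -(leq_pmul2r c0) (leq_trans _ gap) // leq_addr.
  exists T2, w, (n - (a + b))%N; rewrite addnS w1 w2 wc; split=> //; split.
    by rewrite mulnBl leq_subRL ?leq_mul2r ?abn ?orbT.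
  have p0 : (0 < p ^ (a + b))%N by rewrite expn_gt0 prime_gt0.
  by rewrite -(leq_pmul2r p0) -mulnA -expnD subnK.
have grow k : exists (T' : finGroupType) (v : {multiplicative Gamma -> T'}), inv T' v k.
  elim: k => [|k [T' [v vP]]].
    by exists T, u; split=> //; rewrite ?addn0 // expn0 (cardG_gt0 (hom_image_group u)).
  have [T2 [w [n [we w1 w2 wc [vn vw]]]]] := step _ _ _ vP.
  exists T2, w; split=> //; apply: leq_trans vw; rewrite expnSr.
  case: vP => _ _ _ _ vk; apply: leq_mul => //.
  rewrite -[X in (X <= _)%N]expn1; apply: leq_pexp2l; first exact: prime_gt0.
  rewrite lt0n; apply: contraTneq vn => ->.
  by rewrite mul0n -ltnNge (cardG_gt0 (hom_image_group v)).
have [k klt] := linear_leq_exp2 (e.+1 * d * (x1 * x2 * c)).+1.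
have [T' [v vP]] := grow k; have [T2 [w [n [we _ _ _ [vn vw]]]]] := step _ _ _ vP.
have nd : (n <= (e + k.+1) * d)%N.
  rewrite -(leq_exp2l _ _ (prime_gt1 p_prime)) expnM.
  apply: leq_trans (bounded we); apply: leq_trans vw.
  by rewrite leq_pmull // (cardG_gt0 (hom_image_group v)).
suff : (p ^ k < p ^ k)%N by rewrite ltnn.
have vk : (p ^ k <= #|hom_image v|)%N by case: vP.
apply: leq_ltn_trans vk _; apply: leq_ltn_trans vn _.
apply: (@leq_ltn_trans (e.+1 * d * (x1 * x2 * c) * k.+1)).
  rewrite [leqRHS]mulnAC leq_mul2r; apply/orP; right; apply: leq_trans nd _.
  rewrite [leqRHS]mulnAC leq_mul2r; apply/orP; right.
  by rewrite mulSn addnC leq_add2l leq_pmulr.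
apply: leq_trans (leq_trans klt _); first by rewrite ltn_mul2r ltnSn.
by case: (k) => // k'; rewrite leq_exp2r // prime_gt1.
Qed.

End BoundedOrders.

(** * Finite quotients of the completion *)

Section FiniteQuotients.
Local Open Scope classical_set_scope.
Local Open Scope card_scope.
Local Open Scope group_scope.

(** The action of G on the cosets of N by left translation, made into a
    homomorphism to permutations (which compose from left to right) by acting
    through inverses. *)
Lemma p_power_normal_hom p (G : groupType) (N : set G) : prime p ->
  p_power_normal p N -> exists (T : finGroupType) (u : {multiplicative G -> T}) e,
    (forall g, N g <-> u g = 1) /\ forall g, u g ^+ (p ^ e) = 1.
Proof.
move=> p_pr [nN [n /card_set_bijP[/= b [bI binj bsurj]] pn]].
have [[N1 NM NV] NJ] := nN.
have phiP x : (b (left_coset x N) < n)%N by apply: bI; exists x.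
pose phi x : 'I_n := Ordinal (phiP x).
have phiE x y : phi x = phi y <-> N (x^-1 * y).
  rewrite -left_coset_eq //; split=> [/(congr1 val) /= e|e].
    by apply: binj => //; apply/mem_set; [exists x | exists y].
  by apply: val_inj; rewrite /= e.
have [r rP] : {r : 'I_n -> G & forall c, phi (r c) = c}.
  apply: (@choice _ _ (fun (c : 'I_n) h => phi h = c)) => c.
  have [_ [x _ <-] e] := bsurj c (ltn_ord c).
  by exists x; apply: val_inj.
pose act g (c : 'I_n) := phi (g^-1 * r c).
have phiM a x y : phi x = phi y -> phi (a * x) = phi (a * y).
  by move=> /phiE xy; apply/phiE; rewrite invgM -mulgA mulKg.
have act1 c : act 1 c = c by rewrite /act invg1 mul1g rP.
have actM g h c : act (g * h) c = act h (act g c).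
  by rewrite /act invgM -mulgA; apply: phiM; rewrite rP.
have act_inj g : injective (act g).
  by apply: (can_inj (g := act g^-1)) => c; rewrite -actM mulgV act1.
have permM : group_hom (fun g => perm (@act_inj g)).
  by move=> g h; apply/permP => c; rewrite permM !permE actM.
have [u uE] := hom_to_multiplicative permM.
have uP g c : u g c = act g c by rewrite uE permE.
have act_base g : act g (phi 1) = phi g^-1.
  by rewrite -[in RHS](mulg1 g^-1); apply: phiM; rewrite rP.
have cardu : #|hom_image u| = n.
  rewrite -(@card_in_imset _ _ (fun t : {perm 'I_n} => t (phi 1))).
    rewrite -[RHS]card_ord; apply: eq_card => c; rewrite !inE.
    apply/imsetP; exists (u (r c)^-1); first exact: mem_hom_image.
    by rewrite uP act_base invgK rP.
  move=> _ _ /hom_imageP[g <-] /hom_imageP[h <-].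
  rewrite !uP !act_base => /phiE; rewrite invgK => Ngh.
  apply/permP => c; rewrite !uP; apply/phiE.
  by rewrite invgM invgK -mulgA (mulgA g) -conjgE; exact: NJ.
have [e nE] := p_natP pn.
exists {perm 'I_n}, u, e; split=> g.
  split=> [Ng|ug].
    apply/permP => c; rewrite uP perm1 /act -[RHS]rP.
    by apply/phiE; rewrite invgM invgK -mulgA -conjgE; exact: NJ.
  have := congr1 (fun t : {perm 'I_n} => t (phi 1)) ug.
  by rewrite perm1 uP act_base => /phiE; rewrite invgK mulg1.
have {}cardu : #|hom_image_group u| = (p ^ e)%N by rewrite -nE.
by apply/eqP; rewrite -order_dvdn -cardu order_dvdG // mem_hom_image.
Qed.

Lemma hom_p_power_normal p (G : groupType) (T : finGroupType)
    (u : {multiplicative G -> T}) e : prime p -> (forall g, u g ^+ (p ^ e) = 1) ->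
  p_power_normal p [set g | u g = 1].
Proof.
move=> p_pr ue.
have nN : normal_subgroup [set g | u g = 1].
  split; first split => /=.
  - exact: hom1.
  - by move=> x y /= ux uy; rewrite gmulfM ux uy mulg1.
  - by move=> x /= ux; rewrite homV ux invg1.
  - by move=> x y /= ux; rewrite conjgE !gmulfM ux mul1g homV mulVg.
split=> //; pose S : {set 'I_#|T|} := finset.imset enum_rank (mem (hom_image u)).
exists #|S|; last first.
  rewrite card_imset; last exact: enum_rank_inj.
  rewrite -[p.-nat _]/(p.-group (hom_image_group u)) -pnat_exponent.
  apply: (pnat_dvd (n := p ^ e)); last by rewrite pnatX pnat_id.
  by apply/exponentP => _ /hom_imageP[g <-].
rewrite /has_index -(card_eqr (card_eq_finset S)).
have -> : [set` S] = range (fun g => enum_rank (u g)).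
  apply/seteqP; split=> [c /= /imsetP[_ /hom_imageP[g <-] ->]|_ [g _ <-]] /=.
    by exists g.
  by apply/imsetP; exists (u g) => //; exact: mem_hom_image.
apply: eq_card_range => x y; rewrite left_coset_eq //=; split=> [/eqP|].
  by rewrite gmulfM homV -eq_mulVg1 => /eqP->.
by move=> /enum_rank_inj xy; rewrite gmulfM homV xy mulVg.
Qed.

End FiniteQuotients.

Section CompletionPoints.
Local Open Scope classical_set_scope.
Local Open Scope group_scope.
Variables (p : nat) (G : groupType).
Hypothesis p_prime : prime p.
Local Notation Gp := (completion p G).
Local Notation PQ := (p_quotient p G).
Local Notation canonical := Defs.canonical.

Lemma p_quotient_inhabited : inhabited PQ.
Proof.
have one_morph : group_hom (fun _ : G => 1 : {perm 'I_1}).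
  by move=> x y; rewrite mulg1.
have [u uE] := hom_to_multiplicative one_morph.
have kerP : p_power_normal p [set g | u g = 1].
  by apply: (hom_p_power_normal (e := 0)) => // g; rewrite uE expg1n.
by split; exists [set g | u g = 1].
Qed.

Lemma p_quotientI (N M : PQ) : exists L : PQ,
  sval L `<=` sval N /\ sval L `<=` sval M.
Proof.
have [T1 [u1 [e1 [N1 E1]]]] := p_power_normal_hom p_prime (svalP N).
have [T2 [u2 [e2 [N2 E2]]]] := p_power_normal_hom p_prime (svalP M).
have pair_morph : group_hom (fun g => (u1 g, u2 g) : (T1 * T2)%type).
  by move=> x y; rewrite !gmulfM.
have [u uE] := hom_to_multiplicative pair_morph.
have kerP : p_power_normal p [set g | u g = 1].
  apply: (hom_p_power_normal (e := (e1 + e2)%N)) => // g; rewrite uE.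
  have -> n : ((u1 g, u2 g) : (T1 * T2)%type) ^+ n = (u1 g ^+ n, u2 g ^+ n).
    by elim: n => [//|n IHn]; rewrite !expgS IHn.
  by congr pair; rewrite expnD; [|rewrite mulnC]; rewrite expgM ?E1 ?E2 expg1n.
exists (exist _ _ kerP); split=> g /=; rewrite uE => -[] u1g u2g.
  by apply/N1.
by apply/N2.
Qed.

Lemma component_sub (N M : PQ) (x y : Gp) : sval N `<=` sval M ->
  component x N = component y N -> component x M = component y M.
Proof.
move=> NM xy; have [g gE] := componentP x N.
have [a aE] := componentP x M; have [b bE] := componentP y M.
have nM := p_quotient_normal M; have [[N1 _ _] _] := p_quotient_normal N.
have gN : component x N g by rewrite gE; apply/left_cosetE; rewrite mulVg.
have xg := component_compat NM gN.
have yg : component y M g by apply: component_compat NM _ _; rewrite -xy.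
move: xg yg; rewrite aE bE => /left_cosetE ag /left_cosetE bg.
rewrite -[RHS](_ : left_coset g (sval M) = _); last first.
  by apply/esym/left_coset_eq.
by apply/left_coset_eq.
Qed.

Lemma canonicalM x y : canonical p (x * y) = canonical p x * canonical p y :> Gp.
Proof.
by apply: completion_ext => N /=; rewrite mul_left_coset //; exact: p_quotient_normal.
Qed.

Lemma canonical_rep (y : Gp) (N : PQ) :
  exists g, component y N = component (canonical p g) N.
Proof. by have [g gE] := componentP y N; exists g. Qed.

Lemma component_canonical_eq x y (N : PQ) :
  component (canonical p x) N = component (canonical p y) N <-> sval N (x^-1 * y).
Proof. by apply: left_coset_eq; exact: p_quotient_normal. Qed.

(** The projection of the completion to the finite group G / N, up to an
    identification of the latter with a finite group type. *)
Lemma component_hom (N : PQ) :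
  exists (T : finGroupType) (v : {multiplicative Gp -> T}) e,
    (forall x y, v x = v y <-> component x N = component y N) /\
    forall x, v x ^+ (p ^ e) = 1.
Proof.
have [T [u [e [Nu ue]]]] := p_power_normal_hom p_prime (svalP N).
have [r rP] := choice (fun y => canonical_rep y N).
have uE x y : u x = u y <-> component (canonical p x) N = component (canonical p y) N.
  rewrite component_canonical_eq Nu gmulfM homV; split=> [->|/eqP].
    by rewrite mulVg.
  by rewrite -eq_mulVg1 => /eqP.
have v_morph : group_hom (fun y => u (r y)).
  move=> x y; rewrite -gmulfM; apply/uE; rewrite -rP /= rP (rP y).
  by rewrite mul_left_coset //; exact: p_quotient_normal.
have [v vE] := hom_to_multiplicative v_morph.
exists T, v, e; rewrite vE; split=> // x y.
by rewrite uE -!rP.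
Qed.

Lemma ultra_finite (I : Type) (U : set_system I) (T : finType) (t : I -> T) :
  UltraFilter U -> exists c, U [set i | t i = c].
Proof.
move=> UU; apply: contrapT => no.
have : \forall i \near U, forall c, t i <> c.
  apply: filter_forall => c; have [Uc|//] := in_ultra_setVsetC [set i | t i = c] UU.
  by case: no; exists c.
by move=> /filter_ex[i /(_ (t i))].
Qed.

(** Compactness of the completion, in the form in which it is used: along an
    ultrafilter each of the finitely-valued components is eventually constant,
    and the eventual values are compatible. *)
Lemma ultralimit (I : Type) (U : set_system I) (z : I -> Gp) : UltraFilter U ->
  exists y : Gp, forall N, U [set i | component (z i) N = component y N].
Proof.
move=> UU.
have lim (N : PQ) : exists X, U [set i | component (z i) N = X].
  have [T [v [e [vP _]]]] := component_hom N.
  have [c Uc] := ultra_finite (fun i => v (z i)) UU.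
  have [i0 ic] := filter_ex Uc.
  by exists (component (z i0) N); apply: filterS Uc => i /= ci; apply/vP; rewrite ci.
have [X XP] := choice lim.
have XcosetP N : exists g, X N = left_coset g (sval N).
  by have [i /= <-] := filter_ex (XP N); exact: componentP.
have Xcompat N M : sval N `<=` sval M -> X N `<=` X M.
  move=> NM; have [i [/= <- <-]] := filter_ex (filterI (XP N) (XP M)).
  exact: component_compat.
by exists (Completion XcosetP Xcompat).
Qed.

(** An ultrafilter that contains the quotients finer than any given one. *)
Lemma tail_ultrafilter : exists U : set_system PQ, UltraFilter U /\
  forall N : PQ, U [set M : PQ | sval M `<=` sval N].
Proof.
pose tail := filter_from [set: PQ] (fun N : PQ => [set M : PQ | sval M `<=` sval N]).
have tail_filter : ProperFilter tail.
  apply: filter_from_proper; last by move=> N _; exists N.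
  apply: filter_from_filter; first by have [N] := p_quotient_inhabited; exists N.
  move=> N M _ _; have [L [LN LM]] := p_quotientI N M.
  by exists L => // P PL; split; apply: classical_sets.subset_trans PL _.
have [U [UU tU]] := ultraFilterLemma tail_filter.
by exists U; split=> // N; apply: tU; exists N.
Qed.

(** The kernels of the projections form a neighbourhood base, because the set of
    normal subgroups of p-power index is directed. *)
Lemma nbhs_completion (y : Gp) (A : set Gp) : nbhs y A ->
  exists N : PQ, [set z | component z N = component y N] `<=` A.
Proof.
rewrite nbhsE => -[B [oB By] BA].
pose F := filter_from [set: PQ]
  (fun N : PQ => [set z : Gp | component z N = component y N]).
have FF : Filter F.
  apply: filter_from_filter; first by have [N] := p_quotient_inhabited; exists N.
  move=> N M _ _; have [L [LN LM]] := p_quotientI N M.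
  by exists L => // z /= zL; split; apply: component_sub zL.
have cF : (@components p G) @ F --> components y.
  apply/cvg_sup => N O [_ [[V oV <-]] Vt VO].
  exists N => // z /= zN; apply: VO => /=; by rewrite /components zN.
case: oB => O oO OB.
have : F ((@components p G) @^-1` O).
  by apply: cF; apply: open_nbhs_nbhs; split=> //; move: By; rewrite -OB.
by case=> N _ NO; exists N; apply: classical_sets.subset_trans BA; rewrite -OB.
Qed.

End CompletionPoints.

Section BoundedGeneration.
Local Open Scope classical_set_scope.
Local Open Scope group_scope.

(** G / N is a product of d cyclic groups when N is normal of finite index, so
    that negative exponents can be dispensed with. *)
Definition bounded_mod (G : groupType) (N : set G) d := exists g : 'I_d -> G,
  forall x, exists n : 'I_d -> nat, N (x^-1 * \prod_(i < d) g i ^+ n i).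

Lemma hom_prod (G T : groupType) (f : {multiplicative G -> T}) (I : Type)
    (r : seq I) (P : pred I) (F : I -> G) :
  f (\prod_(i <- r | P i) F i) = \prod_(i <- r | P i) f (F i).
Proof. by apply: (big_morph f); [exact: gmulfM | exact: hom1]. Qed.

Lemma expVg_nat (T : finGroupType) (x : T) n : exists k, x ^- n = x ^+ k.
Proof.
have /cycleP[k kE] : x ^- n \in <[x]> by rewrite groupV groupX // cycle_id.
by exists k.
Qed.

Variables (p : nat) (G : groupType).
Hypothesis p_prime : prime p.
Local Notation Gp := (completion p G).
Local Notation PQ := (p_quotient p G).
Local Notation canonical := Defs.canonical.

Lemma bounded_mod_of_completion : boundedly_generated Gp ->
  exists d, forall N : PQ, bounded_mod (sval N) d.
Proof.
move=> [d [g gP]]; exists d => N.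
have [T [v [e [vP _]]]] := component_hom p_prime N.
have [h hP] := choice (fun i => canonical_rep (g i) N).
exists h => x; have [y yP xE] := gP (canonical p x).
have powP i : exists n, v (y i) = v (canonical p (h i)) ^+ n.
  have [z [zC zN]] := yP i _ (nbhs_component (y i) N).
  have <- : v z = v (y i) by apply/vP.
  have -> : v (canonical p (h i)) = v (g i) by apply/vP; rewrite hP.
  case: zC => -[n _ <-]; first by exists n; rewrite homX.
  by rewrite homV homX; exact: expVg_nat.
have [n nP] := choice powP; exists n.
apply/(component_canonical_eq (p := p)); apply/vP.
have [c cE] := hom_to_multiplicative (@canonicalM p G).
rewrite xE -cE !hom_prod; apply: eq_bigr => i _.
by rewrite nP !homX cE.
Qed.

(** The generators are limits, along a tail ultrafilter, of generators of the
    finite quotients; being one of finitely many values in each quotient, the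
    limit is attained there.  The factors of a given x are then obtained as
    limits of powers of these generators. *)
Lemma completion_of_bounded_mod d :
  (forall N : PQ, bounded_mod (sval N) d) -> boundedly_generated Gp.
Proof.
move=> /choice[gN gNP]; have [U [UU tailU]] := tail_ultrafilter G p_prime.
have [g gP] := choice (fun i : 'I_d =>
  ultralimit p_prime (fun N => canonical p (gN N i)) UU).
have [c cE] := hom_to_multiplicative (@canonicalM p G).
exists d, g => x.
have cover (M : PQ) : exists n : 'I_d -> nat,
    component x M = component (\prod_(i < d) g i ^+ n i) M.
  have [N [/= giN NM]] := filter_ex (filterI (filter_forall _ (fun i => gP i M)) (tailU M)).
  have [a aE] := canonical_rep x N; have [n nP] := gNP N a; exists n.
  have [T [v [e [vP _]]]] := component_hom p_prime M.
  have -> : component x M = component (canonical p (\prod_(i < d) gN N i ^+ n i)) M.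
    apply: (component_sub NM); rewrite aE.
    by apply/component_canonical_eq.
  apply/vP; rewrite -cE !hom_prod; apply: eq_bigr => i _.
  rewrite !homX cE; congr (_ ^+ _); apply/vP; exact: giN.
have [n nP] := choice cover.
have [y yP] := choice (fun i : 'I_d => ultralimit p_prime (fun N => g i ^+ n N i) UU).
exists y => [i A yA|].
  have [M MA] := nbhs_completion p_prime yA.
  have [N /= NM] := filter_ex (yP i M).
  exists (g i ^+ n N i); split; first by left; exists (n N i).
  exact: MA.
apply: completion_ext => M.
have [N [/= yN NM]] := filter_ex (filterI (filter_forall _ (fun i => yP i M)) (tailU M)).
have [T [v [e [vP _]]]] := component_hom p_prime M.
rewrite (component_sub NM (nP N)); apply/vP; rewrite !hom_prod.
by apply: eq_bigr => i _; apply/vP.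
Qed.

End BoundedGeneration.

Section Separation.
Local Open Scope classical_set_scope.
Local Open Scope group_scope.
Variables (p : nat) (K G : groupType).
Hypothesis p_prime : prime p.
Local Notation Kp := (completion p K).
Local Notation Gp := (completion p G).
Local Notation canonical := Defs.canonical.

(** Uniform continuity: each component of the value depends on one component of
    the argument. *)
Definition componentwise (phi : Kp -> Gp) := forall M : p_quotient p G,
  exists L : p_quotient p K, forall x y,
    component x L = component y L -> component (phi x) M = component (phi y) M.

Lemma completion_map_componentwise (f : {multiplicative K -> G}) :
  componentwise (completion_map p f).
Proof. by move=> M; exists (pullback f M) => x y /= ->. Qed.

(** If every N admitted a point z with P for which phi z and y agree at N, the
    limit of these points would have image y.  The condition P on a single
    component passes to the limit. *)
Lemma separation (phi : Kp -> Gp) (M : p_quotient p K) (P : set K -> Prop) (y : Gp) :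
  componentwise phi -> (forall z, P (component z M) -> phi z <> y) ->
  exists N, forall z, P (component z M) -> component (phi z) N <> component y N.
Proof.
move=> phiC phiy; apply: contrapT => no.
have [z zP] : {z : p_quotient p G -> Kp & forall N,
    P (component (z N) M) /\ component (phi (z N)) N = component y N}.
  apply: (@choice _ _ (fun N z => P (component z M) /\
    component (phi z) N = component y N)) => N.
  apply: contrapT => noz; apply: no; exists N => z Pz zN.
  by apply: noz; exists z.
have [U [UU tailU]] := tail_ultrafilter G p_prime.
have [k kP] := ultralimit p_prime z UU.
have Pk : P (component k M).
  by have [N /= <-] := filter_ex (kP M); case: (zP N).
apply: (phiy k Pk); apply: completion_ext => N.
have [L phiL] := phiC N.
have [N' [/= kN' NN']] := filter_ex (filterI (kP L) (tailU N)).
rewrite -(phiL _ _ kN'); apply: component_sub NN' _.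
by case: (zP N').
Qed.

(** [separation] applied to the points that are nontrivial modulo M, whose
    images avoid 1 by injectivity. *)
Lemma cofinal_pullback (f : {multiplicative K -> G}) :
  injective (completion_map p f) -> forall M : p_quotient p K,
  exists N : p_quotient p G, f @^-1` sval N `<=` sval M.
Proof.
move=> f_inj M.
have f1 : completion_map p f 1 = 1.
  by rewrite -[1]/(canonical p 1) completion_map_canonical hom1.
have [|z zM f1z|N NP] := @separation (completion_map p f) M
    (fun X => X <> component (1 : Kp) M) 1.
- exact: completion_map_componentwise.
- by apply: zM; congr component; apply: f_inj; rewrite f1.
exists N => k /= Nk; apply: contrapT => nMk.
apply: (NP (canonical p k)).
  move=> kM; apply: nMk.
  have := iffLR (component_canonical_eq 1 k M) (esym kM).
  by rewrite invg1 mul1g.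
rewrite completion_map_canonical.
by apply/(component_canonical_eq (f k) 1); case: (p_quotient_normal N) => -[_ _ NV] _; rewrite mulg1; exact: NV.
Qed.

End Separation.

(** * Index two in the completion and in finite quotients *)

Section IndexTwo.
Local Open Scope classical_set_scope.
Local Open Scope card_scope.
Local Open Scope group_scope.
Variables (G : groupType) (A : set G).
Hypothesis sA : subgroup A.

Lemma subgroup_coset_eq x y : left_coset x A = left_coset y A <-> A (x^-1 * y).
Proof.
have [A1 AM AV] := sA; split=> [e|Axy].
  have : left_coset y A y by apply/left_cosetE; rewrite mulVg.
  by rewrite -e => /left_cosetE.
apply/seteqP; split=> z /left_cosetE h; apply/left_cosetE.
  by have := AM _ _ (AV _ Axy) h; rewrite invgM invgK -mulgA mulVKg.
by have := AM _ _ Axy h; rewrite -mulgA mulVKg.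
Qed.

Lemma has_index2_outside x y : has_index A 2 -> ~ A x -> ~ A y -> A (x^-1 * y).
Proof.
move=> /card_set_bijP[/= b [bI binj _]] nx ny.
have bE g h : b (left_coset g A) = b (left_coset h A) -> A (g^-1 * h).
  move=> e; apply/subgroup_coset_eq/binj => //; apply/mem_set.
    by exists g.
  by exists h.
have b2 g : (b (left_coset g A) < 2)%N by apply: bI; exists g.
have bx : b (left_coset x A) <> b (left_coset 1 A).
  by move=> /esym/bE; rewrite invg1 mul1g.
have by_ : b (left_coset y A) <> b (left_coset 1 A).
  by move=> /esym/bE; rewrite invg1 mul1g.
apply: bE; move: bx by_ (b2 x) (b2 y) (b2 1).
by case: (b _) => [|[|]] //; case: (b _) => [|[|]] //; case: (b _) => [|[|]].
Qed.

Lemma has_index2_intro x : ~ A x -> (forall y, ~ A y -> A (x^-1 * y)) ->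
  has_index A 2.
Proof.
move=> nx xA; have [A1 AM AV] := sA.
pose b g : 'I_2 := if `[< A g >] then ord0 else ord_max.
have <- : #|[set: 'I_2]%SET| = 2 by rewrite cardsT card_ord.
rewrite /has_index -(card_eqr (card_eq_finset [set: 'I_2]%SET)).
have -> : [set` [set: 'I_2]%SET] = range b.
  apply/seteqP; split=> c _; last by rewrite /= inE.
  have [c0|c0] := eqVneq c ord0.
    by exists 1 => //; rewrite /b c0; case: asboolP.
  exists x => //; rewrite /b; case: asboolP => // _; apply: val_inj.
  by move: c0 (ltn_ord c); rewrite -val_eqE /=; case: (val c) => [|[|]].
apply: eq_card_range => g h; rewrite subgroup_coset_eq /b.
case: asboolP => Ag; case: asboolP => Ah; split=> //.
- by move=> _; apply: AM => //; exact: AV.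
- by move=> Agh; case: Ah; have := AM _ _ Ag Agh; rewrite mulVKg.
- by move=> Agh; case: Ag; have := AM _ _ Ah (AV _ Agh); rewrite invgM invgK mulVKg.
- move=> _; have := AM _ _ (AV _ (xA _ Ag)) (xA _ Ah).
  by rewrite invgM invgK -mulgA mulVKg.
Qed.

End IndexTwo.

Section FiniteIndex.
Variable gT : finGroupType.
Implicit Types (X C : {group gT}).

Lemma index_gt2 X C x y : C \subset X -> x \in X -> y \in X ->
  x \notin C -> y \notin C -> x^-1 * y \notin C -> (2 < #|X : C|)%N.
Proof.
move=> CX xX yX xC yC xyC; rewrite -card_lcosets.
have cosetE a b : (a *: C == b *: C) = (b^-1 * a \in C).
  by apply/eqP/idP => [/lcoset_eqP|h]; [|apply/lcoset_eqP]; rewrite mem_lcoset.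
apply: (@leq_trans #|[set 1 *: C; x *: C; y *: C]|); last first.
  apply: subset_leq_card; apply/subsetP => Z; rewrite !inE -orbA.
  by case/or3P => /eqP->; apply/lcosetsP; [exists 1|exists x|exists y].
rewrite -setUA !cardsU1 cards1 !inE !cosetE !mulg1 !groupV.
by rewrite (negPf xC) (negPf yC) -groupV invMg invgK (negPf xyC).
Qed.

Lemma index_le2 X C : C \subset X ->
  (forall x y, x \in X -> y \in X -> x \notin C -> y \notin C -> x^-1 * y \in C) ->
  (#|X : C| <= 2)%N.
Proof.
move=> CX XC; have [XCs|] := boolP (X \subset C).
  by apply: leq_trans (_ : _ <= 1)%N _ => //; rewrite leqNgt indexg_gt1 XCs.
case/subsetPn => x xX xC; rewrite -card_lcosets.
apply: (@leq_trans #|[set 1 *: C; x *: C]|); last first.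
  by rewrite cards2; case: (_ != _).
apply: subset_leq_card; apply/subsetP => _ /lcosetsP[y yX ->]; rewrite !inE.
have [yC|yC] := boolP (y \in C).
  by apply/orP; left; apply/eqP/lcoset_eqP; rewrite mem_lcoset invg1 mul1g.
by apply/orP; right; apply/eqP/lcoset_eqP; rewrite mem_lcoset XC.
Qed.

Lemma leq_mulD_eq2 a b : (1 < a -> 1 < b -> a * b <= a + b -> a = 2)%N.
Proof.
case: a b => [|[|[|a]]] [|[|b]] // _ _.
rewrite leqNgt => /negP[]; rewrite mulnS ltn_add2l.
by apply: (@leq_trans (3 * b.+1)); rewrite ?leq_mul2r ?orbT // mulnS !addSn !ltnS leq_pmull.
Qed.

End FiniteIndex.

Section SpanPowers.
Variables (G : groupType) (T : finGroupType) (u : {multiplicative G -> T}).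

Lemma span_of_powers d (g : 'I_d -> G) :
  (forall x, exists n : 'I_d -> nat, u x = \prod_(i < d) u (g i) ^+ n i) ->
  exists l : seq T, [/\ size l = d, {subset l <= hom_image u} &
    hom_image u \subset cyclic_span l].
Proof.
move=> gP; exists [seq u (g i) | i <- index_enum 'I_d]; split.
- rewrite size_map -[RHS]card_ord -(card_uniqP (index_enum_uniq _)).
  by apply: eq_card => i; rewrite mem_index_enum.
- by move=> _ /mapP[i _ ->]; exact: mem_hom_image.
apply/subsetP => _ /hom_imageP[x <-]; have [n ->] := gP x.
rewrite /cyclic_span big_map; apply: mem_prodg => i _.
exact: mem_cycle.
Qed.

Lemma powers_of_span d (l : seq T) : (size l <= d)%N ->
  {subset l <= hom_image u} -> hom_image u \subset cyclic_span l ->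
  exists g : 'I_d -> G,
    forall x, exists n : 'I_d -> nat, u x = \prod_(i < d) u (g i) ^+ n i.
Proof.
move=> ld lu ul; pose l' := l ++ nseq (d - size l) 1.
have sl' : size l' = d by rewrite size_cat size_nseq subnKC.
have lu' i : nth 1 l' i \in hom_image u.
  have [il|il] := ltnP i (size l'); last by rewrite nth_default // (group1 (hom_image_group u)).
  have := mem_nth 1 il; rewrite mem_cat => /orP[/lu//|].
  by rewrite mem_nseq => /andP[_ /eqP->]; exact: (group1 (hom_image_group u)).
have ul' : hom_image u \subset cyclic_span l'.
  rewrite cyclic_span_cat; apply: subset_trans ul _.
  by rewrite -{1}[cyclic_span l]mulg1 mulgS // sub1set cyclic_span1.
have [g gP] : exists g : 'I_d -> G, forall i, u (g i) = nth 1 l' i.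
  have ex (i : 'I_d) : exists g, u g = nth 1 l' i by apply/hom_imageP.
  by have [g gP] := boolp.choice ex; exists g.
exists g => x; have := subsetP ul' _ (mem_hom_image u x).
rewrite /cyclic_span (big_nth 1) big_mkord sl' => /prodsgP[c cP ->].
have [n nP] : exists n : 'I_d -> nat, forall i, c i = u (g i) ^+ n i.
  have ex i : exists n, c i = u (g i) ^+ n.
    by apply/cycleP; rewrite gP cP.
  by have [n nP] := boolp.choice ex; exists n.
by exists n; apply: eq_bigr => i _.
Qed.

End SpanPowers.

(** The lift of the two maps to the subgroup generated by the images agrees with
    u by uniqueness, so u has its values in that subgroup. *)
Lemma amalgam_image (K H1 H2 Gamma : groupType)
    (i1 : {multiplicative K -> H1}) (i2 : {multiplicative K -> H2})
    (j1 : {multiplicative H1 -> Gamma}) (j2 : {multiplicative H2 -> Gamma})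
    (T : finGroupType) (u : {multiplicative Gamma -> T}) :
  amalgamated_free_product i1 i2 j1 j2 ->
  hom_image u = hom_image (u \o j1) <*> hom_image (u \o j2).
Proof.
move=> am; set S := (hom_image_group (u \o j1) <*> hom_image_group (u \o j2))%G.
rewrite -[RHS]/(gval S); apply/eqP; rewrite eqEsubset join_subG.
apply/and3P; split; [|exact: hom_image_comp_sub|exact: hom_image_comp_sub].
have S1 h : u (j1 h) \in S.
  by apply: (subsetP (joing_subl _ _)); exact: (mem_hom_image (u \o j1)).
have S2 h : u (j2 h) \in S.
  by apply: (subsetP (joing_subr _ _)); exact: (mem_hom_image (u \o j2)).
have t1M : group_hom (fun h => subg S (u (j1 h))).
  by move=> x y; rewrite !gmulfM; apply: (morphM (subg_morphism S)).
have t2M : group_hom (fun h => subg S (u (j2 h))).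
  by move=> x y; rewrite !gmulfM; apply: (morphM (subg_morphism S)).
have [t1 t1E] := hom_to_multiplicative t1M.
have [t2 t2E] := hom_to_multiplicative t2M.
have [k|w [w1 w2]] := amalgam_lift am (t1 := t1) (t2 := t2).
  by rewrite t1E t2E (amalgam_comm am).
have wM : group_hom (fun g => sgval (w g)) by move=> x y; rewrite gmulfM.
have [v vE] := hom_to_multiplicative wM.
have uv : u =1 v.
  apply: (amalgam_unique am) => h; rewrite vE.
    by rewrite w1 t1E subgK.
  by rewrite w2 t2E subgK.
by apply/subsetP => _ /hom_imageP[g <-]; rewrite uv vE subgP.
Qed.

Section QuotientIndex.
Local Open Scope classical_set_scope.
Local Open Scope group_scope.
Variables (p : nat) (K H G : groupType).
Hypothesis p_prime : prime p.
Variables (f1 : {multiplicative K -> H}) (f2 : {multiplicative H -> G}).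
Local Notation canonical := Defs.canonical.
Local Notation F1 := (completion_map p f1).
Local Notation F2 := (completion_map p f2).
Local Notation A := (range (completion_map p f1)).

(** The homomorphism u has kernel N, and v is its extension to the
    completion. *)
Definition quotient_at (N : p_quotient p G) (T : finGroupType)
    (v : {multiplicative completion p G -> T}) (u : {multiplicative G -> T}) :=
  (forall x y, v x = v y <-> component x N = component y N) /\
  (forall g, u g = v (canonical p g)).

Lemma completion_map_multiplicative (G1 G2 : groupType) (f : {multiplicative G1 -> G2}) :
  exists F : {multiplicative completion p G1 -> completion p G2},
    F = completion_map p f :> (_ -> _).
Proof. by apply: hom_to_multiplicative; case: (completion_map_hom p f). Qed.

Lemma range_subgroup (G1 G2 : groupType) (f : {multiplicative G1 -> G2}) :
  subgroup (range (completion_map p f)).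
Proof.
have [F FE] := completion_map_multiplicative f; rewrite -FE; split.
- by exists 1 => //; exact: hom1.
- by move=> _ _ [x _ <-] [y _ <-]; exists (x * y) => //; exact: gmulfM.
- by move=> _ [x _ <-]; exists x^-1 => //; exact: homV.
Qed.

Lemma quotient_at_exists (N : p_quotient p G) :
  exists (T : finGroupType) (v : {multiplicative completion p G -> T})
    (u : {multiplicative G -> T}) e,
    quotient_at N v u /\ forall g, u g ^+ (p ^ e) = 1.
Proof.
have [T [v [e [vP ve]]]] := component_hom p_prime N.
have uM : group_hom (fun g => v (canonical p g)).
  by move=> x y; rewrite canonicalM gmulfM.
have [u uE] := hom_to_multiplicative uM.
by exists T, v, u, e; split; [split|] => // g; rewrite uE.
Qed.

Lemma quotient_at_kernel (N : p_quotient p G) (T : finGroupType)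
    (v : {multiplicative completion p G -> T}) (u : {multiplicative G -> T}) g :
  quotient_at N v u -> sval N g <-> u g = 1.
Proof.
move=> [vP uE].
have v1 : v (canonical p 1) = 1 by rewrite -uE hom1.
rewrite uE -v1 vP; split=> [Ng|e].
  apply/esym/(component_canonical_eq 1 g).
  by rewrite invg1 mul1g.
have := iffLR (component_canonical_eq 1 g N) (esym e).
by rewrite invg1 mul1g.
Qed.

Definition outside_mod N (x : completion p H) :=
  forall k, component (F2 (F1 k)) N <> component (F2 x) N.

Lemma outside_separated : injective F2 -> forall x, ~ A x ->
  exists N, outside_mod N x.
Proof.
move=> F2_inj x nAx; have [M] := p_quotient_inhabited K p_prime.
have [|z _ zx|N NP] := @separation p K G p_prime (F2 \o F1) M (fun _ => True) (F2 x).
- move=> N; have [L LP] := completion_map_componentwise f2 N.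
  have [L' LP'] := completion_map_componentwise f1 L.
  by exists L' => a b /LP'/LP.
- by apply: nAx; exists z => //; exact: F2_inj.
by exists N => k; exact: NP.
Qed.

Lemma outside_mod_sub (N M : p_quotient p G) x : sval M `<=` sval N ->
  outside_mod N x -> outside_mod M x.
Proof. by move=> MN Nx k kM; apply: (Nx k); exact: component_sub kM. Qed.

Variables (N : p_quotient p G) (T : finGroupType).
Variables (v : {multiplicative completion p G -> T}) (u : {multiplicative G -> T}).
Hypothesis uv : quotient_at N v u.
Local Notation X := (hom_image (u \o f2)).
Local Notation C := (hom_image (u \o f2 \o f1)).

Lemma map_image (x : completion p H) : exists h, v (F2 x) = u (f2 h).
Proof.
have [h hE] := canonical_rep x (pullback f2 N); exists h.
have [vP uE] := uv; rewrite uE -completion_map_canonical; apply/vP.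
by rewrite /= hE.
Qed.

Lemma mem_map_image x : v (F2 x) \in X.
Proof. by have [h ->] := map_image x; exact: (mem_hom_image (u \o f2)). Qed.

Lemma hom_imageC t : t \in C -> exists k, v (F2 (F1 k)) = t.
Proof.
move=> /hom_imageP[k <-]; exists (canonical p k).
by rewrite !completion_map_canonical /=; case: uv => _ ->.
Qed.

Lemma outside_notin x : outside_mod N x -> v (F2 x) \notin C.
Proof.
move=> Nx; apply/negP => /hom_imageC[k]; case: uv => vP _ /vP; exact: Nx.
Qed.

Lemma outside_index_gt1 x : outside_mod N x -> (1 < #|X : C|)%N.
Proof.
move=> /outside_notin xC; rewrite indexg_gt1; apply: contra xC => /subsetP; apply.
exact: mem_map_image.
Qed.

Lemma outside_index_gt2 x y : outside_mod N x -> outside_mod N y ->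
  outside_mod N (x^-1 * y) -> (2 < #|X : C|)%N.
Proof.
move=> /outside_notin xC /outside_notin yC /outside_notin xyC.
have [F FE] := completion_map_multiplicative f2.
apply: (@index_gt2 _ (hom_image_group _) (hom_image_group _) (v (F2 x)) (v (F2 y))) => //.
- exact: hom_image_comp_sub.
- exact: mem_map_image.
- exact: mem_map_image.
- by move: xyC; rewrite -FE gmulfM homV gmulfM homV.
Qed.

Lemma has_index2_index_le2 : has_index A 2 -> (#|X : C| <= 2)%N.
Proof.
move=> A2; have [F FE] := completion_map_multiplicative f2.
have inC x : A x -> v (F2 x) \in C.
  case=> k _ <-; have [h hE] := canonical_rep (F1 k) (pullback f2 N).
  have [k' kE] := canonical_rep k (pullback f1 (pullback f2 N)).
  have -> : v (F2 (F1 k)) = u (f2 (f1 k')).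
    have [vP uE] := uv; rewrite uE -!completion_map_canonical; apply/vP.
    by rewrite /= kE.
  exact: (mem_hom_image (u \o f2 \o f1)).
have lift t : t \in X -> exists x, t = v (F2 x).
  move=> /hom_imageP[h <-]; exists (canonical p h).
  by rewrite completion_map_canonical; case: uv => _ <-.
apply: (@index_le2 _ (hom_image_group _) (hom_image_group _)
  (hom_image_comp_sub _ _)).
move=> _ _ /lift[x ->] /lift[y ->] xC yC.
have -> : (v (F2 x))^-1 * v (F2 y) = v (F2 (x^-1 * y)).
  by rewrite -FE !(gmulfM, homV).
apply: (inC (x^-1 * y)); apply: has_index2_outside A2 _ _.
- exact: range_subgroup.
- by move=> /inC vx; rewrite vx in xC.
- by move=> /inC vy; rewrite vy in yC.
Qed.

End QuotientIndex.

(** * From finite quotients to the theorem *)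

Section FromQuotientsToCompletions.
Local Open Scope classical_set_scope.
Local Open Scope group_scope.

Lemma hom_image_pgroup p (G : groupType) (T : finGroupType)
    (u : {multiplicative G -> T}) e : prime p ->
  (forall g, u g ^+ (p ^ e) = 1) -> p.-group (hom_image u).
Proof.
move=> p_pr ue; rewrite -(pnat_exponent _ (hom_image_group u)).
apply: (pnat_dvd (n := p ^ e)); last by rewrite pnatX pnat_id.
by apply/exponentP => _ /hom_imageP[g <-].
Qed.

Lemma kernel_prod (G : groupType) (T : finGroupType) (u : {multiplicative G -> T})
    (N : set G) d (g : 'I_d -> G) (n : 'I_d -> nat) x :
  (forall y, N y <-> u y = 1) ->
  N (x^-1 * \prod_(i < d) g i ^+ n i) <-> u x = \prod_(i < d) u (g i) ^+ n i.
Proof.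
move=> Nu; rewrite Nu gmulfM homV hom_prod.
under eq_bigr do rewrite homX.
split=> [/eqP|->]; last by rewrite mulVg.
by rewrite -eq_mulVg1 => /eqP.
Qed.

Lemma order_of_bounded_mod p (G : groupType) d : prime p ->
  (forall N : p_quotient p G, bounded_mod (sval N) d) ->
  forall (T : finGroupType) (u : {multiplicative G -> T}) e,
  (forall g, u g ^+ (p ^ e) = 1) -> (#|hom_image u| <= (p ^ e) ^ d)%N.
Proof.
move=> p_pr bG T u e ue.
have [g gP] := bG (exist _ _ (hom_p_power_normal p_pr ue)).
have [x|l [<- lu ul]] := @span_of_powers _ _ u d g.
  have [n nP] := gP x; exists n.
  exact: (iffLR (kernel_prod (N := [set y | u y = 1]) g n x (fun y => iff_refl _)) nP).
apply: leq_trans (subset_leq_card ul) _.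
apply: card_cyclic_span; first by rewrite expn_gt0 prime_gt0.
by move=> _ /lu /hom_imageP[x <-].
Qed.

(** A second nontrivial coset of the range would be separated, together with
    the one of x, in some finite quotient, where the index would exceed 2. *)
Lemma index_two_of_quotients p (K H G : groupType) (f1 : {multiplicative K -> H})
    (f2 : {multiplicative H -> G}) (N0 : p_quotient p G) x : prime p ->
  injective (completion_map p f2) -> ~ range (completion_map p f1) x ->
  (forall (N : p_quotient p G) (T : finGroupType)
     (v : {multiplicative completion p G -> T}) (u : {multiplicative G -> T}) e,
     sval N `<=` sval N0 -> quotient_at N v u -> (forall g, u g ^+ (p ^ e) = 1) ->
     #|hom_image (u \o f2) : hom_image (u \o f2 \o f1)| = 2) ->
  has_index (range (completion_map p f1)) 2.
Proof.
move=> p_pr f2_inj nAx two.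
apply: (has_index2_intro (range_subgroup p f1) nAx) => y nAy.
apply: contrapT => nAxy.
have [N1 N1x] := outside_separated p_pr f2_inj nAx.
have [N2 N2y] := outside_separated p_pr f2_inj nAy.
have [N3 N3xy] := outside_separated p_pr f2_inj nAxy.
have [N4 [N40 N41]] := p_quotientI p_pr N0 N1.
have [N5 [N52 N53]] := p_quotientI p_pr N2 N3.
have [N [N4s N5s]] := p_quotientI p_pr N4 N5.
have [T [v [u [e [uv ue]]]]] := quotient_at_exists p_pr N.
have := outside_index_gt2 uv (outside_mod_sub _ N1x) (outside_mod_sub _ N2y)
  (outside_mod_sub _ N3xy).
rewrite (two N T v u e) //; last by move=> g /N4s/N40.
have s1 : sval N `<=` sval N1 by move=> g /N4s/N41.
have s2 : sval N `<=` sval N2 by move=> g /N5s/N52.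
have s3 : sval N `<=` sval N3 by move=> g /N5s/N53.
by move=> /(_ s1 s2 s3).
Qed.

End FromQuotientsToCompletions.

Local Open Scope classical_set_scope.
Local Open Scope group_scope.

Theorem theorem3p7 (p : nat) (K H1 H2 Gamma : groupType)
    (i1 : {multiplicative K -> H1}) (i2 : {multiplicative K -> H2})
    (j1 : {multiplicative H1 -> Gamma}) (j2 : {multiplicative H2 -> Gamma})
    (p_prime : prime p)
    (amalgam : amalgamated_free_product i1 i2 j1 j2)
    (entrance : exact_pro_p_entrance p i1 i2 j1 j2)
    (proper1 : range (completion_map p i1) `<` [set: completion p H1])
    (proper2 : range (completion_map p i2) `<` [set: completion p H2]) :
  boundedly_generated (completion p Gamma) <->
  boundedly_generated (completion p K) /\
  [/\ p = 2%N, has_index (range (completion_map p i1)) 2 &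
      has_index (range (completion_map p i2)) 2].
Proof.
have [i1_inj i2_inj [P [k1 [k2 [[_ k1_inj k2_inj] [w [wiso wk1 wk2]]]]]]] := entrance.
have w_inj : injective w by have [_ [w' [_ wK _]]] := wiso; exact: can_inj wK.
have j1_inj : injective (completion_map p j1) by rewrite -wk1; exact: inj_comp.
have j2_inj : injective (completion_map p j2) by rewrite -wk2; exact: inj_comp.
have C12 (T : finGroupType) (u : {multiplicative Gamma -> T}) :
    hom_image (u \o j2 \o i2) = hom_image (u \o j1 \o i1).
  apply/setP => t; apply/hom_imageP/hom_imageP => -[k <-]; exists k => /=.
    by rewrite (amalgam_comm amalgam).
  by rewrite (amalgam_comm amalgam).
split=> [BG|[BK [p2 I1 I2]]].
  have [d bd] := bounded_mod_of_completion p_prime BG.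
  have ex_out (H : groupType) (f : {multiplicative K -> H}) :
      range (completion_map p f) `<` [set: completion p H] ->
      exists x, ~ range (completion_map p f) x.
    move=> [_ nAll]; apply: contrapT => no; apply: nAll => x _.
    by apply: contrapT => nx; apply: no; exists x.
  have [x1 x1A] := ex_out _ _ proper1; have [x2 x2A] := ex_out _ _ proper2.
  have [N1 N1x] := outside_separated p_prime j1_inj x1A.
  have [N2 N2x] := outside_separated p_prime j2_inj x2A.
  have [N0 [N01 N02]] := p_quotientI p_prime N1 N2.
  have two (N : p_quotient p Gamma) (T : finGroupType)
      (v : {multiplicative completion p Gamma -> T})
      (u : {multiplicative Gamma -> T}) e :
      sval N `<=` sval N0 -> quotient_at N v u -> (forall g, u g ^+ (p ^ e) = 1) ->
      #|hom_image (u \o j1) : hom_image (u \o j1 \o i1)| = 2 /\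
      #|hom_image (u \o j2) : hom_image (u \o j2 \o i2)| = 2.
    move=> NN0 uv ue.
    have s1 : sval N `<=` sval N1 by move=> g /NN0/N01.
    have s2 : sval N `<=` sval N2 by move=> g /NN0/N02.
    have a1 := outside_index_gt1 uv (outside_mod_sub s1 N1x).
    have b1 := outside_index_gt1 uv (outside_mod_sub s2 N2x).
    have := amalgam_index_bound amalgam p_prime (order_of_bounded_mod p_prime bd) ue.
    have L1 := Lagrange (hom_image_comp_sub (u \o j1) i1); have L2 := Lagrange (hom_image_comp_sub (u \o j2) i2).
    move: a1 b1 L1 L2 => /=; rewrite C12.
    set a := #|_ : _|; set b := #|hom_image (u \o j2) : _|; set c := #|_| => a1 b1 <- <-.
    rewrite -mulnDr mulnACA [leqRHS]mulnA leq_pmul2l; last first.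
      by rewrite muln_gt0 (cardG_gt0 (hom_image_group (u \o j1 \o i1))).
    move=> ab; split; first exact: leq_mulD_eq2 a1 b1 ab.
    by apply: leq_mulD_eq2 b1 a1 _; rewrite mulnC addnC.
  have [T [v [u [e [uv ue]]]]] := quotient_at_exists p_prime N0.
  have [a2 b2] := two N0 T v u e (fun _ => id) uv ue.
  have p2 : p = 2.
    have pX : p.-group (hom_image_group (u \o j1)) 
      by apply: (hom_image_pgroup (e := e)) => // g; exact: ue.
    have /pgroupP/(_ 2 isT) := pX; rewrite -(Lagrange (hom_image_comp_sub (u \o j1) i1)) /= a2.
    by move/(_ (dvdn_mull _ (dvdnn 2))); rewrite inE => /eqP.
  have I1 : has_index (range (completion_map p i1)) 2.
    apply: (index_two_of_quotients (N0 := N0) p_prime j1_inj x1A).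
    by move=> N T' v' u' e' NN uv' ue'; case: (two N T' v' u' e').
  have I2 : has_index (range (completion_map p i2)) 2.
    apply: (index_two_of_quotients (N0 := N0) p_prime j2_inj x2A).
    by move=> N T' v' u' e' NN uv' ue'; case: (two N T' v' u' e').
  split=> //; have [e0 eP] := normal_cyclic_span d.
  apply: (completion_of_bounded_mod p_prime (d := e0)) => M.
  have [L LM] := cofinal_pullback p_prime i1_inj M.
  have [N NL] := cofinal_pullback p_prime j1_inj L.
  clear T v u e uv ue a2 b2.
  have [T [v [u [e [uv ue]]]]] := quotient_at_exists p_prime N.
  have Nu g := quotient_at_kernel g uv.
  have [g gP] := bd N.
  have [x|l [sl lu ul]] := @span_of_powers _ _ u d g.
    by have [n nP] := gP x; exists n; exact: (iffLR (kernel_prod g n x Nu) nP).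
  have le1 := has_index2_index_le2 j1 uv I1.
  have le2 := has_index2_index_le2 j2 uv I2.
  have s1 := hom_image_comp_sub (u \o j1) i1.
  have s2 := hom_image_comp_sub (u \o j2) i2.
  rewrite C12 in le2 s2.
  have p_u : 2.-group (hom_image u) by rewrite -p2; exact: hom_image_pgroup ue.
  have uE := amalgam_image u amalgam.
  rewrite uE in p_u lu ul.
  pose X1 := hom_image_group (u \o j1); pose X2 := hom_image_group (u \o j2).
  pose C := hom_image_group (u \o j1 \o i1).
  have [nC _] := @dihedral_quotient _ C X1 X2 s1 s2 le1 le2.
  have cM := @dihedral_Mho1_cyclic _ C X1 X2 p_u s1 s2 le1 le2.
  have [l' [lC Cl le]] := eP _ (X1 <*> X2)%G C l p_u nC cM lu ul sl.
  have [h hP] := powers_of_span (u := u \o j1 \o i1) le lC Cl.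
  exists h => k; have [n nP] := hP k; exists n.
  apply: LM; apply: NL; apply/Nu => /=.
  by apply/(kernel_prod (u := u \o j1 \o i1) h n k (fun y => iff_refl _)).
have [d bd] := bounded_mod_of_completion p_prime BK.
apply: (completion_of_bounded_mod p_prime (d := d.+2)) => N.
have [T [v [u [e [uv ue]]]]] := quotient_at_exists p_prime N.
have Nu g := quotient_at_kernel g uv.
have [g gP] := bd (pullback i1 (pullback j1 N)).
have [k|l [sl lC Cl]] := @span_of_powers _ _ (u \o j1 \o i1) d g.
  have [n nP] := gP k; exists n.
  apply: (iffLR (kernel_prod (u := u \o j1 \o i1) g n k _) nP) => y /=.
  exact: Nu.
have le1 := has_index2_index_le2 j1 uv I1.
have le2 := has_index2_index_le2 j2 uv I2.
have s1 := hom_image_comp_sub (u \o j1) i1.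
have s2 := hom_image_comp_sub (u \o j2) i2.
rewrite C12 in le2 s2.
pose X1 := hom_image_group (u \o j1); pose X2 := hom_image_group (u \o j2).
pose C := hom_image_group (u \o j1 \o i1).
have [l' [lX Xl sl']] := @dihedral_cyclic_span _ C X1 X2 l s1 s2 le1 le2 lC Cl.
have uE := amalgam_image u amalgam.
rewrite -[X1 <*> X2]uE in lX Xl.
have [|h hP] := powers_of_span (d := d.+2) _ lX Xl; first by rewrite sl' sl.
exists h => x; have [n nP] := hP x; exists n.
exact/(kernel_prod h n x Nu).
Qed.
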